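(* Let $q$ be a prime power, $m\ge 2$ an integer not divisible by the characteristic of $\mathbb{F}_q$, and $f(x)\in\mathbb{F}_q[x]$ a polynomial with $\deg(f)\ge 2$, all of whose roots lie in $\mathbb{F}_q$, which is not a $d$-th power of an element of $\mathbb{F}_q(x)$ for any divisor $d>1$ of $m$. Let $\mathcal{X}: y^m=f(x)$, with function field $F=\mathbb{F}_q(\mathcal{X})=\mathbb{F}_q(x,y)$. Let $P_1,\dots,P_r$ be the (distinct) places of $\mathbb{F}_q(x)$ that are zeros or poles of $f(x)$, and $\lambda_k=\nu_{P_k}(f(x))$ for $1\le k\le r$. Let $n\le r$ be such that $P_1,\dots,P_n$ are totally ramified in $F/\mathbb{F}_q(x)$, let $Q_k$ be the unique place of $F$ over $P_k$ for $1\le k\le n$, and let $\mathbf{Q}=(Q_1,\dots,Q_n)$. Assume $2\le n\le q$, and let $\alpha=(\alpha_1,\dots,\alpha_n)\in\mathbb{Z}^n$. Let $\Upsilon$ denote either $\Gamma$ or $\Lambda$, and let $\rho=0$ if $\Upsilon=\Gamma$ and $\rho=n-2$ if $\Upsilon=\Lambda$. Then $\alpha\in\widehat{\Upsilon}(\mathbf{Q})$ if and only if there exists a unique $t\in\{0,\dots,m-1\}$ such that $\alpha_k+t\lambda_k\equiv 0\pmod m$ for every $1\le k\le n$ and $$\sum_{k=1}^{n}\left\lceil\frac{\alpha_k}{m}\right\rceil+\sum_{k=1}^{r}\left\lfloor\frac{t\lambda_k}{m}\right\rfloor=\rho .$$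
   Context: $\nu_P$ is the discrete valuation at a place $P$. Let $F/\mathbb{F}_q$ be a function field and $\mathbf{Q}=(Q_1,\dots,Q_n)$ an $n$-tuple of distinct rational places. Let $R_{\mathbf{Q}}$ be the ring of functions in $F$ regular outside $\{Q_1,\dots,Q_n\}$. The generalized Weierstrass semigroup is $$\widehat{H}(\mathbf{Q})=\{(-\nu_{Q_1}(z),\dots,-\nu_{Q_n}(z))\in\mathbb{Z}^n : z\in R_{\mathbf{Q}}\setminus\{0\}\}.$$ Let $I=\{1,\dots,n\}$. For a nonempty $J\subsetneq I$ and $\alpha\in\mathbb{Z}^n$ let $$\nabla_J(\alpha)=\{\beta\in\widehat{H}(\mathbf{Q}) : \beta_j=\alpha_j \text{ for } j\in J,\ \beta_i<\alpha_i \text{ for } i\notin J\},\qquad \nabla(\alpha)=\bigcup_{i=1}^n\nabla_{\{i\}}(\alpha).$$ An element $\alpha\in\widehat{H}(\mathbf{Q})$ is maximal if $\nabla(\alpha)=\emptyset$. It is absolute maximal if it is maximal and $\nabla_J(\alpha)=\emptyset$ for every $J\subsetneq I$ with $|J|\ge 2$; it is relative maximal if it is maximal and $\nabla_J(\alpha)\ne\emptyset$ for every $J\subsetneq I$ with $|J|\ge2$. $\widehat{\Gamma}(\mathbf{Q})$ and $\widehat{\Lambda}(\mathbf{Q})$ denote the sets of absolute maximal and relative maximal elements of $\widehat{H}(\mathbf{Q})$, respectively. *)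

(* Defs.v *)
From HB Require Import structures.
From mathcomp Require Import all_boot all_order all_algebra all_field.

Set Implicit Arguments.
Unset Strict Implicit.
Unset Printing Implicit Defensive.

Import Order.TTheory GRing.Theory Num.Theory.
Local Open Scope ring_scope.

(* A place of F/K is identified with its normalized discrete valuation, K being
   embedded in F by i.  The value +oo at 0 is encoded as 0: this makes pointwise
   equality [=1] the equality of places, and [0 <= p z] says, for all z (also
   z = 0), that z is regular at p. *)
Record place (K F : fieldType) (i : {rmorphism K -> F}) := Place {
  place_val :> F -> int;
  place_val0 : place_val 0 = 0;
  place_valM : forall x y, x != 0 -> y != 0 ->
    place_val (x * y) = place_val x + place_val y;
  place_valD : forall x y, x != 0 -> y != 0 -> x + y != 0 ->
    Num.min (place_val x) (place_val y) <= place_val (x + y);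
  place_val_const : forall c, c != 0 -> place_val (i c) = 0;
  place_val_unif : exists x, place_val x = 1
}.

Section Semigroup.

Variables (K F : fieldType) (i : {rmorphism K -> F}).
Variables (n : nat) (Q : 'I_n -> place i).
Implicit Types (alpha beta : 'I_n -> int) (J : {set 'I_n}).

Definition regular_outside (z : F) : Prop :=
  forall p : place i, (forall k, ~ (p =1 Q k)) -> 0 <= p z.

Definition gen_semigroup alpha : Prop :=
  exists z : F, [/\ z != 0, regular_outside z & forall k, alpha k = - Q k z].

Definition nablaJ J alpha beta : Prop :=
  [/\ gen_semigroup beta,
      forall j, j \in J -> beta j = alpha j
    & forall j, j \notin J -> beta j < alpha j].

Definition nabla alpha beta : Prop := exists j, nablaJ [set j] alpha beta.

Definition maximal alpha : Prop :=
  gen_semigroup alpha /\ ~ exists beta, nabla alpha beta.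

Definition abs_maximal alpha : Prop :=
  maximal alpha /\
  forall J, J \proper [set: 'I_n] -> (2 <= #|J|)%N ->
    ~ exists beta, nablaJ J alpha beta.

Definition rel_maximal alpha : Prop :=
  maximal alpha /\
  forall J, J \proper [set: 'I_n] -> (2 <= #|J|)%N ->
    exists beta, nablaJ J alpha beta.

End Semigroup.

Notation ratfun K := {fraction {poly K}}.

Definition ratfun_const (K : fieldType) : {rmorphism K -> ratfun K} :=
  @tofrac {poly K} \o polyC.

Definition ext_const (K : fieldType) (L : fieldExtType (ratfun K)) :
    {rmorphism K -> L} :=
  in_alg L \o ratfun_const K.

Section Ramification.

Variables (K : fieldType) (L : fieldExtType (ratfun K)).
Implicit Types (P : place (ratfun_const K)) (Q : place (ext_const L)).

Definition lies_over Q P : Prop := forall z, 0 < P z -> 0 < Q z%:A.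

Definition has_ram_index Q P (e : nat) : Prop :=
  forall z, Q z%:A = e%:Z * P z.

Definition totally_ramified P : Prop :=
  exists Q, [/\ lies_over Q P,
                forall Q', lies_over Q' P -> Q' =1 Q
              & has_ram_index Q P (\dim {:L})].

End Ramification.

Definition ceil_div (a : int) (m : nat) : int :=
  Num.ceil (a%:~R / m%:R : rat).

Definition floor_div (a : int) (m : nat) : int :=
  Num.floor (a%:~R / m%:R : rat).

(* Main.v *)
(* Write z = sum_{t < m} c_t y^t with c_t in K(x). At a totally ramified place
   Q_k the exponent lambda_k is prime to m, so the terms have values
   m P_k(c_t) + t lambda_k in distinct classes mod m and Q_k(z) is their
   minimum. The terms of a function z regular outside Q are themselves regular
   outside Q: if z is regular at all places over p, then z is integral over the
   local ring at p, so the coordinates of all powers of z have bounded poles at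
   p; comparing with z^N for N = 1 mod m a power of the characteristic, whose
   coordinates are c_t^N f^(t(N-1)/m), gives m p(c_t) + t p(f) >= 0. That an
   element which is not integral has a pole at some place follows from Zorn's
   lemma, a maximal subring containing 1/z but not z being a discrete valuation
   ring.

   Hence the semigroup consists of the componentwise maxima of vectors alpha
   that lie in one class t (m | alpha_k + t lambda_k for all k) and have
   S_t(alpha) = sum_k ceil(alpha_k/m) + sum_k floor(t lambda_k/m) >= 0, the
   latter being the condition for the existence of a function of K(x) with the
   prescribed behaviour. Lowering an entry of alpha by m lowers S_t by 1, so
   nabla_J(alpha), for alpha in class t and J nonempty, is nonempty iff S_t(alpha) >= n - |J|. *)

Require Import Defs.
From HB Require Import structures.
From mathcomp Require Import all_boot all_order all_algebra all_field.
From mathcomp Require Import generic_quotient cyclic zify ring.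
From mathcomp Require boolp classical_sets.

Set Implicit Arguments.
Unset Strict Implicit.
Unset Printing Implicit Defensive.

Import Order.TTheory GRing.Theory Num.Theory.
Local Open Scope ring_scope.

(** * Discrete valuations *)

Section Valuations.

Variable L : fieldType.
Implicit Types (v : L -> int) (x y z : L) (c d : int).

Definition valuation v : Prop :=
  [/\ v 0 = 0,
      forall x y, x != 0 -> y != 0 -> v (x * y) = v x + v y
    & forall x y, x != 0 -> y != 0 -> x + y != 0 ->
        Num.min (v x) (v y) <= v (x + y)].

(* [v x >= c] with the convention [v 0 = +oo], which the encoding [v 0 = 0] loses. *)
Definition vge v c x : bool := (x == 0) || (c <= v x).

Lemma vge0 v c : vge v c 0.
Proof. by rewrite /vge eqxx. Qed.

Lemma vge_neq0 v c x : x != 0 -> vge v c x = (c <= v x).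
Proof. by rewrite /vge => /negPf ->. Qed.

Lemma vge_refl v x : vge v (v x) x.
Proof. by rewrite /vge lexx orbT. Qed.

Lemma vge_le v c d x : c <= d -> vge v d x -> vge v c x.
Proof. by rewrite /vge => cd /orP[->//|dx]; rewrite (le_trans cd dx) orbT. Qed.

Section Fix.

Variables (v : L -> int) (vP : valuation v).

Lemma val0 : v 0 = 0. Proof. by case: vP. Qed.

Lemma vge00 x : vge v 0 x = (0 <= v x).
Proof. by rewrite /vge; case: eqP => [->|//]; rewrite val0 lexx. Qed.

Lemma valM x y : x != 0 -> y != 0 -> v (x * y) = v x + v y.
Proof. by case: vP => _ + _; apply. Qed.

Lemma val1 : v 1 = 0.
Proof.
have o0 : (1 : L) != 0 by exact: oner_neq0.
by have := valM o0 o0; rewrite mulr1; lia.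
Qed.

Lemma valV x : v x^-1 = - v x.
Proof.
have [->|x0] := eqVneq x 0; first by rewrite invr0 val0.
have xV0 : x^-1 != 0 by rewrite invr_eq0.
by have := valM x0 xV0; rewrite divff // val1; lia.
Qed.

Lemma val_div x y : x != 0 -> y != 0 -> v (x / y) = v x - v y.
Proof. by move=> x0 y0; rewrite valM ?invr_eq0 // valV. Qed.

Lemma valX x n : v (x ^+ n) = n%:Z * v x.
Proof.
have [->|x0] := eqVneq x 0.
  by rewrite expr0n val0; case: n => [|n]; rewrite ?val1 ?val0 /=; lia.
elim: n => [|n IHn]; first by rewrite expr0 val1 mul0r.
by rewrite exprS valM ?expf_neq0 // IHn; lia.
Qed.

Lemma valXz x (n : int) : v (x ^ n) = n * v x.
Proof.
by case: n => n; rewrite -?exprnP ?NegzE -?exprnN ?valV valX //; lia.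
Qed.

Lemma valN1 : v (-1) = 0.
Proof. by have := valX (-1) 2; rewrite sqrrN expr1n val1; lia. Qed.

Lemma valN x : v (- x) = v x.
Proof.
have [->|x0] := eqVneq x 0; first by rewrite oppr0.
by rewrite -mulN1r valM ?valN1 ?add0r // oppr_eq0 oner_eq0.
Qed.

Lemma vgeN c x : vge v c (- x) = vge v c x.
Proof. by rewrite /vge oppr_eq0 valN. Qed.

Lemma vgeD c x y : vge v c x -> vge v c y -> vge v c (x + y).
Proof.
have [->|x0] := eqVneq x 0; first by rewrite add0r.
have [->|y0] := eqVneq y 0; first by rewrite addr0.
have [->|xy0] := eqVneq (x + y) 0; first by rewrite vge0.
rewrite !vge_neq0 // => cx cy; case: vP => _ _ /(_ x y x0 y0 xy0).
by apply: le_trans; rewrite le_min cx cy.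
Qed.

Lemma vgeB c x y : vge v c x -> vge v c y -> vge v c (x - y).
Proof. by move=> cx cy; rewrite vgeD ?vgeN. Qed.

Lemma vgeM c d x y : vge v c x -> vge v d y -> vge v (c + d) (x * y).
Proof.
have [->|x0] := eqVneq x 0; first by rewrite mul0r !vge0.
have [->|y0] := eqVneq y 0; first by rewrite mulr0 !vge0.
by rewrite !vge_neq0 ?mulf_neq0 // valM //; lia.
Qed.

Lemma vgeM0 x y : vge v 0 x -> vge v 0 y -> vge v 0 (x * y).
Proof. by move=> hx hy; have := vgeM hx hy; rewrite addr0. Qed.

Lemma vge_sum (I : Type) (r : seq I) (p : pred I) (E : I -> L) c :
  (forall i, p i -> vge v c (E i)) -> vge v c (\sum_(i <- r | p i) E i).
Proof. by move=> hE; elim/big_rec: _ => [|i x pi hx]; rewrite ?vge0 ?vgeD ?hE. Qed.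

(** Strict triangle inequality. If [x + y] vanished or had a value above [v x], then
    [x = (x + y) - y] would too. Nonvanishing is part of the conclusion because the value 0 at 0
    would not reveal it. *)
Lemma val_addl x y : x != 0 -> vge v (v x + 1) y ->
  x + y != 0 /\ v (x + y) = v x.
Proof.
move=> x0; have [->|y0] := eqVneq y 0; first by rewrite addr0.
rewrite vge_neq0 // => xy.
have xy0 : x + y != 0.
  apply/eqP => /eqP; rewrite addr_eq0 => /eqP xE.
  by move: xy; rewrite xE valN; lia.
split=> //; apply/eqP; rewrite eq_le; apply/andP; split; last first.
  by rewrite -(vge_neq0 v _ xy0) vgeD ?vge_refl // vge_neq0 //; lia.
rewrite leNgt; apply/negP => lt.
have : vge v (v x + 1) (x + y - y) by apply: vgeB; rewrite vge_neq0 //; lia.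
by rewrite addrK vge_neq0 //; lia.
Qed.

(** The nonzero term of least value is strictly below all others, so [val_addl] applies to it and
    the rest of the sum. *)
Lemma val_sum_distinct (I : finType) (E : I -> L) (i0 : I) :
  E i0 != 0 ->
  (forall i j, E i != 0 -> E j != 0 -> v (E i) = v (E j) -> i = j) ->
  \sum_i E i != 0 /\
  exists i, [/\ E i != 0, v (\sum_j E j) = v (E i)
                & forall j, vge v (v (E i)) (E j)].
Proof.
move=> Ei0 Einj.
have [i Ei imin] := Order.TotalTheory.arg_minP (v \o E) (Ei0 : (fun i => E i != 0) i0).
rewrite /= in imin.
have [] := @val_addl (E i) (\sum_(j | j != i) E j) Ei.
  apply: vge_sum => j ji; have [->|Ej] := eqVneq (E j) 0; first exact: vge0.
  rewrite vge_neq0 //; have := imin j Ej; rewrite le_eqVlt => /orP[/eqP/Einj|].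
    by move=> /(_ Ei Ej) ij; rewrite ij eqxx in ji.
  by lia.
have <- : \sum_j E j = E i + \sum_(j | j != i) E j by rewrite (bigD1 i).
move=> s0 sE; split=> //; exists i; split=> // j.
by have [->|Ej] := eqVneq (E j) 0; rewrite ?vge0 // vge_neq0 ?imin.
Qed.

End Fix.

(** The values form a nonzero subgroup of the integers, generated by its least positive element [e];
    the normalized valuation is the quotient by [e]. *)
Lemma valuation_normalize v : valuation v -> (exists x, v x != 0) ->
  exists e : int, exists w : L -> int,
    [/\ 0 < e, valuation w, exists x, w x = 1 & forall x, v x = e * w x].
Proof.
move=> vP [x vx].
pose hasv := [pred n : nat | (0 < n)%N && boolp.asbool (exists z, v z = n%:Z)].
have [|e] := @ex_minnP hasv.
  exists `|v x|%N; rewrite /= absz_gt0 vx /=; apply/boolp.asboolP.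
  have [vx0|vx0] := leP 0 (v x); first by exists x; lia.
  by exists x^-1; rewrite valV //; lia.
move=> /andP[e0 /boolp.asboolP[u vu]] emin.
have u0 : u != 0 by apply/eqP => u0; move: vu; rewrite u0 val0 //; lia.
(* The remainder of [v z] modulo [e] is itself a value, that of [z * u ^ (- a)], so it is 0 by
   minimality of [e]. *)
have dvd z : v z = e%:Z * (v z %/ e%:Z)%Z.
  have [->|z0] := eqVneq z 0; first by rewrite val0 // div0z mulr0.
  have r0 : (0 <= v z %% e%:Z)%Z by rewrite modz_ge0; lia.
  have re : (v z %% e%:Z < e%:Z)%Z by rewrite ltz_pmod; lia.
  have := divz_eq (v z) e%:Z; move: r0 re.
  move: (v z %/ e%:Z)%Z (v z %% e%:Z)%Z => a b b0 be vE.
  have [b00|bN] := eqVneq b 0; first by rewrite vE b00 addr0 mulrC.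
  have zE : v (z * u ^ (- a)) = b.
    by rewrite valM ?expfz_neq0 // valXz // vu vE; lia.
  have := emin `|b|%N; rewrite /= absz_gt0 bN /=.
  case: boolp.asboolP => [_ /(_ isT)|[]]; first by lia.
  by exists (z * u ^ (- a)); rewrite zE; lia.
exists e%:Z, (fun z => (v z %/ e%:Z)%Z); split.
- by lia.
- split.
  + by rewrite val0 // div0z.
  + move=> a b a0 b0; have := dvd (a * b); have := dvd b; have := dvd a.
    rewrite valM //; move: ((v a + v b) %/ _)%Z (v b %/ _)%Z (v a %/ _)%Z; nia.
  + move=> a b a0 b0 ab0; have [_ _ /(_ a b a0 b0 ab0)] := vP.
    have := dvd (a + b); have := dvd b; have := dvd a.
    move: (v (a + b) %/ _)%Z (v b %/ _)%Z (v a %/ _)%Z => qc qb qa -> -> ->.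
    by rewrite !ge_min !ler_pM2l //; lia.
- by exists u; rewrite vu divzz; lia.
- exact: dvd.
Qed.

(** An element of [v]-value 0 and its inverse both have [w]-value at least 0, so [w] vanishes there
    and is [w u] times [v]. As [w] takes the value 1, this factor is 1. *)
Lemma val_dominate v w : valuation v -> valuation w ->
  (exists x, v x = 1) -> (exists x, w x = 1) ->
  (forall x, 0 <= v x -> 0 <= w x) -> v =1 w.
Proof.
move=> vP wP [u vu] [s ws] vw.
have u0 : u != 0 by apply/eqP => u0; move: vu; rewrite u0 val0.
have s0 : s != 0 by apply/eqP => s0; move: ws; rewrite s0 val0.
have wE a : w a = v a * w u.
  have [->|a0] := eqVneq a 0; first by rewrite (val0 vP) (val0 wP) mul0r.
  have b0 : a / u ^ v a != 0 by rewrite mulf_neq0 ?invr_eq0 ?expfz_neq0.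
  have vb : v (a / u ^ v a) = 0.
    by rewrite val_div ?expfz_neq0 // valXz // vu mulr1 subrr.
  have wb : w (a / u ^ v a) = 0.
    have := vw (a / u ^ v a)^-1; have := vw (a / u ^ v a).
    by rewrite (valV vP) vb (valV wP); lia.
  by move: wb; rewrite val_div ?expfz_neq0 // (valXz wP); lia.
have wu : 0 <= w u by rewrite vw // vu.
have wu1 : w u = 1.
  have : (w u %| 1)%Z by apply/dvdzP; exists (v s); rewrite -wE ws.
  by rewrite dvdz1; lia.
by move=> a; rewrite wE wu1 mulr1.
Qed.

End Valuations.

(** * Places from valuation rings *)

Section ValuationRings.

Variable L : fieldType.
Implicit Types (A R : L -> Prop) (x y z w : L).

Definition subring A : Prop :=
  [/\ A 1, forall x y, A x -> A y -> A (x - y)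
    & forall x y, A x -> A y -> A (x * y)].

Section Closure.

Variables (A : L -> Prop) (AP : subring A).

Lemma subring1 : A 1. Proof. by case: AP. Qed.

Lemma subringB x y : A x -> A y -> A (x - y).
Proof. by case: AP => _ + _; apply. Qed.

Lemma subringM x y : A x -> A y -> A (x * y).
Proof. by case: AP => _ _; apply. Qed.

Lemma subring0 : A 0.
Proof. by rewrite -(subrr 1); apply: subringB subring1 subring1. Qed.

Lemma subringN x : A x -> A (- x).
Proof. by move=> Ax; rewrite -[- x]sub0r; apply: subringB subring0 Ax. Qed.

Lemma subringD x y : A x -> A y -> A (x + y).
Proof. by move=> Ax Ay; rewrite -[y]opprK; apply: subringB Ax (subringN Ay). Qed.

Lemma subringX x n : A x -> A (x ^+ n).
Proof.
move=> Ax; elim: n => [|n IHn]; first by rewrite expr0; exact: subring1.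
by rewrite exprS; apply: subringM.
Qed.

Lemma subring_sum (I : Type) (r : seq I) (p : pred I) (E : I -> L) :
  (forall i, p i -> A (E i)) -> A (\sum_(i <- r | p i) E i).
Proof.
by move=> hE; elim/big_rec: _ => [|i x pi]; [exact: subring0 | apply: subringD; apply: hE].
Qed.

Lemma subring_coef_mul (p q : {poly L}) :
  (forall i, A p`_i) -> (forall i, A q`_i) -> forall i, A (p * q)`_i.
Proof. by move=> hp hq i; rewrite coefM; apply: subring_sum => j _; apply: subringM. Qed.

Definition adjoin w x : Prop :=
  exists2 p : {poly L}, (forall i, A p`_i) & x = p.[w].

Lemma subring_adjoin w : subring (adjoin w).
Proof.
split.
- exists 1%:P; last by rewrite hornerC.
  by move=> i; rewrite coefC; case: ifP => _; [exact: subring1 | exact: subring0].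
- move=> _ _ [p hp ->] [q hq ->]; exists (p - q); last by rewrite hornerD hornerN.
  by move=> i; rewrite coefB; apply: subringB.
- move=> _ _ [p hp ->] [q hq ->]; exists (p * q); last by rewrite hornerM.
  exact: subring_coef_mul.
Qed.

Lemma adjoin_sub w x : A x -> adjoin w x.
Proof.
move=> Ax; exists x%:P; last by rewrite hornerC.
by move=> i; rewrite coefC; case: ifP => _ //; exact: subring0.
Qed.

Lemma adjoin_gen w : adjoin w w.
Proof.
exists 'X; last by rewrite hornerX.
by move=> i; rewrite coefX; case: eqP => _; [exact: subring1 | exact: subring0].
Qed.

End Closure.

Definition valuation_ring A : Prop :=
  subring A /\ forall w, w != 0 -> A w \/ A w^-1.

Lemma exists_maximal_subring R z : subring R -> ~ R z ->
  exists A, [/\ subring A, forall x, R x -> A x, ~ A z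
    & forall B, subring B -> (forall x, A x -> B x) -> ~ B z ->
        forall x, B x -> A x].
Proof.
move=> RP Rz.
pose good A := [/\ subring A, forall x, R x -> A x & ~ A z].
(* The premise makes the empty predicate acceptable, as it is the union of the empty chain. *)
pose P A := (exists x, A x) -> good A.
have [C CP Ctot|A [AP Amax]] := @classical_sets.Zorn_bigcup L P.
  case=> x0 [X0 CX0 X0x0].
  have memC X x : C X -> X x -> good X by move=> CX Xx; apply: CP => //; exists x.
  have up2 x y : classical_sets.bigcup C id x -> classical_sets.bigcup C id y ->
      exists X, [/\ C X, good X, X x & X y].
    case=> X CX Xx [Y CY Yy]; have [XY|YX] := Ctot X Y CX CY.
      by exists Y; split=> //; [exact: memC CY Yy | exact: XY].
    by exists X; split=> //; [exact: memC CX Xx | exact: YX].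
  have [R0 sR0 zR0] := memC _ _ CX0 X0x0.
  split; last 1 first.
  - by case=> X CX Xz; have [_ _] := memC _ _ CX Xz; apply.
  - split.
    + by exists X0 => //; exact: subring1 R0.
    + move=> x y Ux Uy; have [X [CX [XR _ _] Xx Xy]] := up2 x y Ux Uy.
      by exists X => //; exact: subringB.
    + move=> x y Ux Uy; have [X [CX [XR _ _] Xx Xy]] := up2 x y Ux Uy.
      by exists X => //; exact: subringM.
  - by move=> x Rx; exists X0 => //; exact: sR0.
have gR : good R by split.
(* An empty maximal element would be strictly contained in [R]. *)
have [Ax|A0] := boolp.pselect (exists x, A x); last first.
  case: (Amax R); last by move=> _.
  split=> [x Ax|RA]; first by case: A0; exists x.
  by case: A0; exists 1; apply: RA; exact: subring1 RP.
have [AR sRA zA] := AP Ax; exists A; split=> // B BR sAB zB x Bx.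
apply: boolp.contrapT => Ax'.
case: (Amax B); last by move=> _; split=> // y Ry; apply: sAB; apply: sRA.
by split=> // /(_ x Bx).
Qed.

(** A subring maximal among those that contain [R] and avoid [z] is a valuation ring, by the
    argument of Chevalley's extension theorem. *)
Lemma exists_valuation_ring R z : subring R -> z != 0 -> R z^-1 -> ~ R z ->
  exists A, [/\ valuation_ring A, forall x, R x -> A x & ~ A z].
Proof.
move=> RP z0 Ru Rz; have [A [AP sRA Az Amax]] := exists_maximal_subring RP Rz.
set u := z^-1 in Ru; have Au : A u by exact: sRA.
(* Inverting all elements [1 + u * b] does not add [z]: from [z = a1 / (1 + u * b1)] and [z * u = 1]
   follows [z + b1 = a1]. By maximality these inverses are already in [A]. *)
have unit1 a : A a -> 1 + u * a != 0 /\ A (1 + u * a)^-1.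
  move=> Aa; have d0 b : A b -> 1 + u * b != 0.
    move=> Ab; apply/eqP => /(congr1 ( *%R z)).
    rewrite mulr0 mulrDr mulr1 mulVKf // => /eqP; rewrite addr_eq0 => /eqP zE.
    by apply: Az; rewrite zE; apply: subringN.
  split; first exact: d0.
  pose B x := exists a b, [/\ A a, A b & x = a / (1 + u * b)].
  have sAB x : A x -> B x.
    move=> Ax; exists x, 0; split=> //; first exact: subring0 AP.
    by rewrite mulr0 addr0 divr1.
  have mulD b c : (1 + u * b) * (1 + u * c) = 1 + u * (b + c + u * b * c) by ring.
  have AmulD b c : A b -> A c -> A (b + c + u * b * c).
    by move=> Ab Ac; do ?[apply: subringD => //]; do ?[apply: subringM => //].
  have A1D b : A b -> A (1 + u * b).
    by move=> Ab; apply: subringD; [|exact: subring1 AP|apply: subringM].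
  have BP : subring B.
    split; first by apply: sAB; exact: subring1 AP.
    - move=> _ _ [a1 [b1 [A1 B1 ->]]] [a2 [b2 [A2 B2 ->]]].
      exists (a1 * (1 + u * b2) - a2 * (1 + u * b1)), (b1 + b2 + u * b1 * b2).
      split; [|exact: AmulD|].
        by apply: subringB => //; apply: subringM => //; exact: A1D.
      rewrite -mulD; have := d0 b1 B1; have := d0 b2 B2.
      move: (1 + u * b1) (1 + u * b2) => c1 c2 c20 c10.
      by field; rewrite c10 c20.
    - move=> _ _ [a1 [b1 [A1 B1 ->]]] [a2 [b2 [A2 B2 ->]]].
      exists (a1 * a2), (b1 + b2 + u * b1 * b2).
      split; [exact: subringM|exact: AmulD|].
      by rewrite -mulD mulf_div.
  apply: (Amax B) => //.
    case=> a1 [b1 [A1 B1 zE]]; apply: Az.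
    have : z * (1 + u * b1) = a1 by rewrite zE divfK ?d0.
    rewrite mulrDr mulr1 mulVKf // => H.
    by rewrite -(addrK b1 z) H; apply: subringB.
  by exists 1, a; split=> //; [exact: subring1 AP|rewrite div1r].
(* Adjoining an element outside [A] must capture [z], by maximality. *)
have zadj w : ~ A w -> exists2 p : {poly L}, (forall i, A p`_i) & z = p.[w].
  move=> Aw; apply: boolp.contrapT => zw; apply: Aw.
  apply: (Amax (adjoin A w)) => //; first exact: subring_adjoin.
    by move=> x; exact: adjoin_sub.
  exact: adjoin_gen.
pose rel w := [pred n | boolp.asbool (exists p : {poly L},
   [/\ (size p <= n)%N, forall i, A p`_i & z = p.[w]])].
have minrel w : ~ A w -> exists n (p : {poly L}),
    [/\ (size p <= n)%N, forall i, A p`_i, z = p.[w]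
      & forall q : {poly L}, (forall i, A q`_i) -> z = q.[w] -> (n <= size q)%N].
  move=> Aw; have [|n /boolp.asboolP[p [szp Ap zp]] nmin] := @ex_minnP (rel w).
    have [p Ap zp] := zadj w Aw; exists (size p); apply/boolp.asboolP.
    by exists p.
  exists n, p; split=> // q Aq zq; apply: nmin; apply/boolp.asboolP.
  by exists q.
(* If neither [w] nor [w^-1] is in [A], the shorter of the two minimal relations
   lowers the degree of the longer one. *)
have reduce w n n' (p p' : {poly L}) : w != 0 ->
    (size p <= n)%N -> (forall i, A p`_i) -> z = p.[w] ->
    (forall q : {poly L}, (forall i, A q`_i) -> z = q.[w] -> (n <= size q)%N) ->
    (size p' <= n')%N -> (forall i, A p'`_i) -> z = p'.[w^-1] ->
  ~~ (n' <= n)%N.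
  move=> w0 szp Ap zp nmin szp' Ap' zp'; apply/negP => le.
  have [e0 Ae] := unit1 (- p'`_0) (subringN AP (Ap' 0%N)).
  set e := 1 + u * - p'`_0 in e0 Ae.
  have n'0 : (0 < n')%N.
    case: n' szp' {le} => // /[!leqn0] /[!size_poly_eq0] /eqP p'0.
    by move: z0; rewrite zp' p'0 horner0 eqxx.
  (* The relation for [w^-1] multiplied by [u = z^-1] reads 1 on the left. Moving its constant term
     over leaves the unit [e], and multiplying by [w ^+ r / e] writes the top power of [w] in [p]
     through lower ones. *)
  have eE : e = \sum_(j < n'.-1) u * p'`_j.+1 * w^-1 ^+ j.+1.
    have : u * z = u * \sum_(j < n') p'`_j * w^-1 ^+ j.
      by rewrite zp' (horner_coef_wide _ szp').
    rewrite mulVf // -(prednK n'0) big_ord_recl expr0 mulr1 mulrDr => H.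
    rewrite /e mulrN {1}H addrAC subrr add0r mulr_sumr.
    by apply: eq_bigr => j _; rewrite mulrA.
  have s0 : (0 < n'.-1)%N.
    by case: (n'.-1) eE => // eE; move: e0; rewrite eE big_ord0 eqxx.
  pose r := n.-1; have nr : n = r.+1 by rewrite /r; lia.
  have wr : w ^+ r = \sum_(j < n'.-1) e^-1 * u * p'`_j.+1 * w ^+ (r - j.+1).
    apply: (mulfI e0); rewrite {1}eE mulr_suml mulr_sumr.
    apply: eq_bigr => j _; rewrite !mulrA mulfV // mul1r -!mulrA; congr (_ * (_ * _)).
    have jr : (j.+1 <= r)%N by have := ltn_ord j; rewrite /r; lia.
    by rewrite -{1}(subnK jr) exprD mulrCA -exprMn mulVf // expr1n mulr1.
  pose q := \poly_(i < r) p`_i +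
    \sum_(j < n'.-1) (p`_r * (e^-1 * u * p'`_j.+1)) *: 'X^(r - j.+1).
  have szq : (size q <= r)%N.
    rewrite (leq_trans (size_polyD _ _)) // geq_max size_poly /=.
    apply: (leq_trans (size_sum _ _ _)); apply/bigmax_leqP => j _.
    by rewrite (leq_trans (size_scale_leq _ _)) // size_polyXn; rewrite /r; lia.
  suff : (n <= size q)%N by rewrite nr; move: szq; lia.
  apply: nmin => [i|].
    rewrite coefD coef_poly coef_sum; apply: subringD => //.
      by case: ifP => _ //; exact: subring0 AP.
    apply: subring_sum => // j _; rewrite coefZ coefXn.
    apply: subringM => //; last first.
      by case: eqP => _; [exact: subring1 AP | exact: subring0 AP].
    by do !apply: subringM => //.
  rewrite hornerD horner_sum horner_poly.
  rewrite zp (horner_coef_wide _ szp) nr big_ord_recr /= wr mulr_sumr.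
  congr (_ + _); apply: eq_bigr => j _; rewrite hornerZ hornerXn.
  by rewrite -[in RHS]mulrA.
exists A; split=> //; split=> // w w0.
apply: boolp.contrapT => Aw.
have [Aw1 Aw2] : ~ A w /\ ~ A w^-1 by split=> h; apply: Aw; [left|right].
have [n [p [sp Ap zp pmin]]] := minrel w Aw1.
have [n' [p' [sp' Ap' zp' pmin']]] := minrel w^-1 Aw2.
have := reduce w n n' p p' w0 sp Ap zp pmin sp' Ap' zp'.
have := reduce w^-1 n' n p' p; rewrite invr_eq0 invrK.
move=> /(_ w0 sp' Ap' zp' pmin' sp Ap zp); lia.
Qed.

End ValuationRings.

(** * Units and associates in a valuation ring *)

Section ValuationRingUnits.

Variables (L : fieldType) (A : L -> Prop) (AV : valuation_ring A).
Implicit Types (u w x y z : L).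

Let AP : subring A. Proof. by case: AV. Qed.

Definition isunit x : Prop := [/\ x != 0, A x & A x^-1].

Lemma isunitV x : isunit x -> isunit x^-1.
Proof. by case=> x0 Ax Ax'; split; rewrite ?invr_eq0 ?invrK. Qed.

Lemma isunitM x y : isunit x -> isunit y -> isunit (x * y).
Proof.
case=> x0 Ax Ax' [y0 Ay Ay']; split; first by rewrite mulf_neq0.
  exact: subringM.
by rewrite invfM; apply: subringM.
Qed.

Lemma isunit1 : isunit 1.
Proof. by have A1 := subring1 AP; split; rewrite ?invr1 ?oner_eq0. Qed.

Lemma isunitX x n : isunit x -> isunit (x ^+ n).
Proof.
move=> ux; elim: n => [|n IHn]; first by rewrite expr0; exact: isunit1.
by rewrite exprS; apply: isunitM.
Qed.

(** If [y^-1] is in the ring and [y ^+ n.+1] too, then so is [y = y ^+ n.+1 * y^-1 ^+ n]. This is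
    used for [x] or its inverse. *)
Lemma isunitX_inv x n : (0 < n)%N -> isunit (x ^+ n) -> isunit x.
Proof.
case: n => // n _ ux; have x0 : x != 0.
  by case: ux; rewrite expf_eq0.
have powV y : y != 0 -> A y^-1 -> isunit (y ^+ n.+1) -> A y.
  move=> y0 Ay' [_ Ay _].
  rewrite (_ : y = y ^+ n.+1 * y^-1 ^+ n); last first.
    by rewrite exprS exprVn mulfK ?expf_neq0.
  by apply: subringM => //; apply: subringX.
have ux' : isunit (x^-1 ^+ n.+1) by rewrite exprVn; apply: isunitV.
have [Ax|Ax'] := AV.2 x x0; split=> //; last exact: powV.
by apply: powV; rewrite ?invr_eq0 ?invrK.
Qed.

(** The ring is local: one of [x / y], [y / x] lies in it, so one of the two summands divides the
    sum, and would be a unit if the sum were. *)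
Lemma nonunit_add x y : A x -> A y -> ~ isunit x -> ~ isunit y -> ~ isunit (x + y).
Proof.
have half x' y' : A x' -> A y' -> ~ isunit y' -> y' != 0 -> A (x' / y') ->
    ~ isunit (x' + y').
  move=> Ax Ay nuy y0 Axy [s0 As As']; apply: nuy; split=> //.
  have -> : y'^-1 = (x' / y' + 1) / (x' + y') by field; rewrite s0 y0.
  by apply: subringM => //; apply: subringD => //; exact: subring1 AP.
move=> Ax Ay nux nuy.
have [->|x0] := eqVneq x 0; first by rewrite add0r.
have [->|y0] := eqVneq y 0; first by rewrite addr0.
have xy0 : x / y != 0 by rewrite mulf_neq0 ?invr_eq0.
have [Axy|] := AV.2 _ xy0; first exact: half.
by rewrite invf_div addrC => Ayx; apply: half.
Qed.

Lemma isunit_addl u x : isunit u -> A x -> ~ isunit x -> isunit (u + x).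
Proof.
move=> uu Ax nux; apply: boolp.contrapT => nus.
have nuNx : ~ isunit (- x).
  case=> x0 _ Ax'; apply: nux; split=> //; first by rewrite -oppr_eq0.
  by rewrite -[x]opprK invrN; apply: subringN.
have := nonunit_add (subringD AP (let: And3 _ Au _ := uu in Au) Ax) (subringN AP Ax).
by rewrite addrK; apply.
Qed.

Lemma nonunitM x y : A x -> A y -> ~ isunit y -> ~ isunit (x * y).
Proof.
move=> Ax Ay nuy [xy0 Axy Axy']; apply: nuy.
move: xy0; rewrite mulf_eq0 negb_or => /andP[x0 y0]; split=> //.
have -> : y^-1 = x * (x * y)^-1 by rewrite invfM mulrA mulfV // mul1r.
exact: subringM.
Qed.

(** The ring form of the fact that the least value in a vanishing sum is attained twice. Divide by a
    term [t i] that divides all others: if no quotient were a unit, the remaining terms would add up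
    to a nonunit, yet they add up to -1. *)
Lemma sum_eq0_associates (n : nat) (t : 'I_n -> L) (k : 'I_n) :
  t k != 0 -> \sum_i t i = 0 ->
  exists i j, [/\ i != j, t i != 0, t j != 0 & isunit (t i / t j)].
Proof.
move=> tk sum0.
have [i [ti imin]] : exists i, t i != 0 /\ forall j, A (t j / t i).
  suff [i [ti imin]] : exists i, t i != 0 /\ forall j, j \in enum 'I_n -> A (t j / t i).
    by exists i; split=> // j; apply: imin; rewrite mem_enum.
  elim: (enum _) => [|j s [i [ti imin]]]; first by exists k.
  have [tj0|tj] := eqVneq (t j) 0.
    exists i; split=> // l; rewrite inE => /orP[/eqP ->|]; last exact: imin.
    by rewrite tj0 mul0r; exact: subring0 AP.
  have r0 : t j / t i != 0 by rewrite mulf_neq0 ?invr_eq0.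
  have [Aji|] := AV.2 _ r0.
    by exists i; split=> // l; rewrite inE => /orP[/eqP ->|]; [|exact: imin].
  rewrite invf_div => Aij; exists j; split=> // l; rewrite inE => /orP[/eqP ->|ls].
    by rewrite divff //; exact: subring1 AP.
  rewrite (_ : t l / t j = t l / t i * (t i / t j)); last by rewrite mulrA divfK.
  by apply: subringM => //; apply: imin.
apply: boolp.contrapT => H.
have nu j : j != i -> ~ isunit (t j / t i).
  move=> ji uji; apply: H; exists j, i; split=> //.
  by case: uji => + _ _; apply: contraNneq => ->; rewrite mul0r.
have nu0 : ~ isunit 0 by case; rewrite eqxx.
have [_ ns] : A (\sum_(j | j != i) t j / t i) /\ ~ isunit (\sum_(j | j != i) t j / t i).
  elim/big_rec: _ => [|j x ji [Ax nux]]; first by split=> //; exact: subring0 AP.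
  by split; [apply: subringD | apply: nonunit_add => //; apply: nu].
have E : 1 + \sum_(j | j != i) t j / t i = 0.
  have := sum0; rewrite (bigD1 i) //= => /(congr1 (fun s => s / t i)).
  by rewrite mulrDl mulfV // mulr_suml mul0r.
apply: ns; have /eqP := E; rewrite addrC addr_eq0 => /eqP ->.
have N1 := subringN AP (subring1 AP).
by split=> //; rewrite ?invrN ?invr1 // oppr_eq0 oner_eq0.
Qed.

End ValuationRingUnits.

(** * Algebraic elements up to units *)

Section AlgebraicAssociates.

Variables (k : fieldType) (F : fieldExtType k).
Implicit Types (a : k) (w : F).

Lemma alg_div a b : (a / b)%:A = a%:A / b%:A :> F.
Proof. by rewrite -!in_algE fmorph_div. Qed.

Lemma algebraic_relation w :
  exists c : 'I_(\dim {:F}).+1 -> k,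
    (exists i, c i != 0) /\ \sum_i c i *: w ^+ i = 0.
Proof.
pose X := [tuple w ^+ i | i < (\dim {:F}).+1].
have nf : ~~ free X.
  apply/negP; rewrite /free size_tuple => /eqP dX.
  by have := dimvS (subvf <<X>>%VS); rewrite dX ltnn.
apply: boolp.contrapT => H; move/negP: nf; apply; apply/freeP => c Xc i.
apply: boolp.contrapT => /eqP ci; apply: H; exists c; split; first by exists i.
rewrite -[RHS]Xc; apply: eq_bigr => j _.
by rewrite -tnth_nth tnth_mktuple.
Qed.

Lemma pow_associate (A : F -> Prop) (pi : F) w : valuation_ring A -> w != 0 ->
  (forall a, a != 0 -> exists s : int, isunit A (a%:A / pi ^ s)) -> pi != 0 ->
  exists s : int, isunit A (w ^+ (\dim {:F})`! / pi ^ s).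
Proof.
move=> AV w0 piP pi0; have [c [[l cl] c0]] := algebraic_relation w.
have tk : c l *: w ^+ l != 0 by rewrite scaler_eq0 negb_or cl expf_neq0.
have [i [j [ij ti tj uij]]] := sum_eq0_associates AV tk c0.
wlog lt_ij : i j ij ti tj uij / (j < i)%N.
  move=> H; have [ji|ji|E] := ltngtP j i; first exact: (H i j).
    apply: (H j i) => //; first by rewrite eq_sym.
    by have := isunitV uij; rewrite invf_div.
  by rewrite (ord_inj E) eqxx in ij.
have ci : c i != 0 by apply: contraNneq ti => ->; rewrite scale0r.
have cj : c j != 0 by apply: contraNneq tj => ->; rewrite scale0r.
have [s us] : exists s : int, isunit A (w ^+ (i - j) / pi ^ s).
  have cc : c j / c i != 0 by rewrite mulf_neq0 ?invr_eq0.
  have [s us] := piP _ cc; exists s.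
  have := isunitM AV uij us; congr (isunit A _).
  rewrite alg_div.
  rewrite -[c i *: w ^+ i]mulr_algl -[c j *: w ^+ j]mulr_algl.
  have ci' : (c i)%:A != 0 :> F by rewrite -in_algE fmorph_eq0.
  have cj' : (c j)%:A != 0 :> F by rewrite -in_algE fmorph_eq0.
  have ij' : (j <= i)%N by exact: ltnW.
  rewrite -{1}(subnK ij') exprD.
  have wj : w ^+ j != 0 by rewrite expf_neq0.
  have ps : pi ^ s != 0 by rewrite expfz_neq0.
  move: (c i)%:A (c j)%:A (w ^+ j) (w ^+ (i - j)) (pi ^ s) ci' cj' wj ps.
  by move=> x y a b d x0 y0 a0 d0; field; rewrite a0 x0 y0 d0.
have dvd : (i - j %| (\dim {:F})`!)%N.
  by apply: dvdn_fact; have := ltn_ord i; lia.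
exists (s * ((\dim {:F})`! %/ (i - j))%N%:Z).
have := isunitX AV ((\dim {:F})`! %/ (i - j)) us.
by rewrite expr_div_n -exprM mulnC divnK // (exprnP (pi ^ s)) exprz_exp.
Qed.

End AlgebraicAssociates.

(** * From a valuation ring of the function field to a place *)

Section PlaceOfRing.

Variables (K : fieldType) (F : fieldExtType (ratfun K)).
Implicit Types (a : ratfun K) (g h : {poly K}) (w z : F).

Lemma ratfun_fracE a :
  exists g h, [/\ h != 0 & a = tofrac g / tofrac h].
Proof.
elim/quotW: a => a; have d0 : \d_a != 0 by exact: denom_ratioP.
exists \n_a, \d_a; split=> //.
apply: (canRL (mulfK _)); first by rewrite tofrac_eq0.
rewrite [LHS]/GRing.mul /=.
rewrite !piE; apply/eqmodP.
rewrite /= FracField.equivfE /FracField.mulf !numden_Ratio ?mulf_neq0 ?oner_neq0 //.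
by rewrite !mulr1 mulrC.
Qed.

Definition polyF g : F := (tofrac g)%:A.

Lemma polyFD : {morph polyF : g h / g + h}.
Proof. by move=> g h; rewrite /polyF rmorphD scalerDl. Qed.

Lemma polyFM : {morph polyF : g h / g * h}.
Proof. by move=> g h; rewrite /polyF rmorphM -in_algE rmorphM. Qed.

Lemma polyF0 : polyF 0 = 0.
Proof. by rewrite /polyF rmorph0 scale0r. Qed.

Lemma polyFX g n : polyF (g ^+ n) = polyF g ^+ n.
Proof. by rewrite /polyF rmorphXn -in_algE rmorphXn. Qed.

Lemma polyF_sum (I : Type) (r : seq I) (p : pred I) (E : I -> {poly K}) :
  polyF (\sum_(i <- r | p i) E i) = \sum_(i <- r | p i) polyF (E i).
Proof. exact: (big_morph polyF polyFD polyF0). Qed.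

Lemma polyF_eq0 g : (polyF g == 0) = (g == 0).
Proof. by rewrite /polyF -in_algE fmorph_eq0 tofrac_eq0. Qed.

Lemma polyF_coef g : polyF g = \sum_(i < size g) polyF (g`_i)%:P * polyF 'X ^+ i.
Proof.
rewrite -[in LHS](coefK g) poly_def polyF_sum; apply: eq_bigr => i _.
by rewrite -mul_polyC polyFM polyFX.
Qed.

Section WithRing.

Variables (A : F -> Prop) (AV : valuation_ring A).
Hypothesis AK : forall c : K, A (polyF c%:P).

Let AP : subring A. Proof. by case: AV. Qed.

Lemma unit_const (c : K) : c != 0 -> isunit A (polyF c%:P).
Proof.
move=> c0; split=> //; first by rewrite polyF_eq0 polyC_eq0.
rewrite (_ : (polyF c%:P)^-1 = polyF (c^-1)%:P) //.
apply: (mulfI (_ : polyF c%:P != 0)); first by rewrite polyF_eq0 polyC_eq0.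
rewrite mulfV ?polyF_eq0 ?polyC_eq0 // -polyFM -polyCM mulfV //.
by rewrite /polyF !rmorph1 scale1r.
Qed.

(** [pi] is a uniformizer for the restriction of the ring to K(x): [x^-1] when [x] is not in the
    ring, and otherwise a nonunit polynomial of least degree. *)
Lemma exists_uniformizer z : ~ A z ->
  exists pi : F, [/\ pi != 0, A pi, ~ A pi^-1
    & forall a, a != 0 -> exists s : int, isunit A (a%:A / pi ^ s)].
Proof.
move=> Az; set x := polyF 'X.
have x0 : x != 0 by rewrite polyF_eq0 polyX_eq0.
have fromPoly (pi : F) : pi != 0 ->
    (forall g, g != 0 -> exists s : int, isunit A (polyF g / pi ^ s)) ->
    forall a, a != 0 -> exists s : int, isunit A (a%:A / pi ^ s).
  move=> pi0 H a; have [g [h [h0 ->]]] := ratfun_fracE a.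
  rewrite mulf_eq0 negb_or tofrac_eq0 => /andP[g0 _].
  have [s us] := H g g0; have [t ut] := H h h0; exists (s - t).
  have := isunitM AV us (isunitV ut); congr (isunit A _).
  rewrite alg_div -/(polyF g) -/(polyF h) expfzDr // -invr_expz.
  have hF0 : polyF h != 0 by rewrite polyF_eq0.
  move: (pi ^ s) (pi ^ t) (expfz_neq0 s pi0) (expfz_neq0 t pi0) => u v u0 v0.
  by field; rewrite u0 v0 hF0.
have [Ax|/[dup] Ax] := boolp.pselect (A x); last first.
  have [//|Axi _] := AV.2 x x0; exists x^-1; split; rewrite ?invr_eq0 ?invrK //.
  apply: fromPoly; rewrite ?invr_eq0 // => g g0; exists (- (size g).-1%:Z).
  have nux : ~ isunit A x^-1 by case=> _ _; rewrite invrK.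
  rewrite exprz_inv opprK -exprnP.
  have sg : size g = (size g).-1.+1 by rewrite prednK // lt0n size_poly_eq0.
  rewrite polyF_coef sg /= big_ord_recr /= mulrDl mulfK ?expf_neq0 // addrC.
  (* Divided by the top power of [x], a polynomial is its leading coefficient, a unit, plus
     multiples of the nonunit [x^-1]. *)
  have xdiv i n : (i <= n)%N -> x ^+ i / x ^+ n = x^-1 ^+ (n - i).
    move=> le; rewrite -{1}(subnK le) exprD invfM exprVn mulrC -mulrA.
    by rewrite mulVf ?mulr1 // expf_neq0.
  rewrite mulr_suml; set S := \sum_(i < _) _.
  have [AS nuS] : A S /\ ~ isunit A S.
    rewrite /S; elim/big_rec: _ => [|i y _ [Ay nuy]].
      by split; [exact: subring0 AP | case; rewrite eqxx].
    have E : polyF (g`_i)%:P * x ^+ i / x ^+ (size g).-1 =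
        polyF (g`_i)%:P * x^-1 ^+ ((size g).-1 - i.+1) * x^-1.
      have le : (i <= (size g).-1)%N by apply: ltnW.
      by rewrite -!mulrA; congr (_ * _); rewrite -exprSr subnSK // xdiv.
    have At : A (polyF (g`_i)%:P * x^-1 ^+ ((size g).-1 - i.+1)).
      by apply: subringM => //; apply: subringX.
    rewrite E; split; first by apply: subringD => //; apply: subringM.
    by apply: nonunit_add => //; [apply: subringM | apply: nonunitM].
  apply: isunit_addl => //; apply: unit_const.
  by rewrite -[_`__]/(lead_coef g) lead_coef_eq0.
have Ag g : A (polyF g).
  rewrite polyF_coef; apply: subring_sum => // i _.
  by apply: subringM => //; apply: subringX.
have [g0 ng0] : exists g, g != 0 /\ ~ isunit A (polyF g).
  apply: boolp.contrapT => H; apply: Az.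
  have ug g : g != 0 -> isunit A (polyF g).
    by move=> g0; apply: boolp.contrapT => ng; apply: H; exists g.
  have [z0|z0] := eqVneq z 0; first by rewrite z0; exact: subring0 AP.
  (* With every nonzero polynomial a unit, [pi = 1] is allowed and a power of [z] becomes a unit,
     against [z] being outside [A]. *)
  have [|s] := @pow_associate _ _ A 1 z AV z0 _ (oner_neq0 _).
    apply: fromPoly => [|g /ug u]; first exact: oner_neq0.
    by exists 0; rewrite expr0z divr1.
  rewrite exp1rz divr1 => /isunitX_inv; rewrite fact_gt0 => /(_ AV isT).
  by case.
pose bad := [pred n | boolp.asbool (exists g, [/\ g != 0, size g = n & ~ isunit A (polyF g)])].
have [|n /boolp.asboolP[p [p0 szp np]] nmin] := @ex_minnP bad.
  by exists (size g0); apply/boolp.asboolP; exists g0; case: ng0.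
have Ap : A (polyF p) by [].
exists (polyF p); split; rewrite ?polyF_eq0 //.
  by move=> Ap'; apply: np; split=> //; rewrite polyF_eq0.
apply: fromPoly; rewrite ?polyF_eq0 // => h.
have [k] := ubnP (size h); elim: k h => // k IHk h szh h0.
(* A nonzero remainder is a unit by minimality of [p], and then so is [h]; otherwise a factor [p]
   splits off and the degree drops. *)
have [r0|r0] := eqVneq (h %% p) 0; last first.
  exists 0; rewrite expr0z divr1 (divp_eq h p) polyFD addrC polyFM.
  apply: isunit_addl => //; last first.
  - by apply: nonunitM.
  - exact: subringM.
  apply: boolp.contrapT => nr; have := nmin (size (h %% p)).
  rewrite leqNgt -szp ltn_modp p0 => /(_ _)/negP; apply => //.
  by apply/boolp.asboolP; exists (h %% p).
have hE : h = h %/ p * p by rewrite {1}(divp_eq h p) r0 addr0.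
have q0 : h %/ p != 0 by apply: contraNneq h0 => q0; rewrite hE q0 mul0r.
have sp1 : (1 < size p)%N.
  rewrite ltnNge; apply/negP => /size1_polyC pE; apply: np; rewrite pE.
  by apply: unit_const; rewrite -polyC_eq0 -pE.
have [|s us] := IHk (h %/ p) _ q0.
  move: szh; rewrite {1}hE size_mul //; move: q0; rewrite -size_poly_gt0.
  by move: (size _) (size p) sp1; lia.
exists (s + 1); rewrite {1}hE polyFM expfzDr ?polyF_eq0 // expr1z invfM.
by rewrite mulrACA mulfV ?mulr1 // polyF_eq0.
Qed.

(* [x ^ M] is, up to units, a power of the uniformizer for a fixed exponent [M];
   reading off that power yields a discrete valuation with ring [A]. *)
Lemma place_of_ring z : ~ A z ->
  exists v : place (ext_const F), (forall w, A w -> 0 <= v w) /\ v z < 0.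
Proof.
move=> Az; have [pi [pi0 Api nApi piP]] := exists_uniformizer Az.
set M := (\dim {:F})`!; have M0 : (0 < M)%N by exact: fact_gt0.
have upow (s : int) : isunit A (pi ^ s) -> s = 0.
  have half (t : nat) : ~ isunit A (pi ^ t.+1).
    move=> u; have : isunit A pi by apply: (@isunitX_inv _ _ AV _ t.+1).
    by case.
  case: s => [[|t]|t] // u; first by case: (half t).
  by case: (half t); rewrite -[pi ^ _]invrK invr_expz -NegzE; apply: isunitV.
have /boolp.choice[v vP] : forall w, exists s : int,
    if w == 0 then s = 0 else isunit A (w ^+ M / pi ^ s).
  move=> w; have [_|w0] := eqVneq w 0; first by exists 0.
  by have [s us] := pow_associate AV w0 piP pi0; exists s.
have v0 : v 0 = 0 by have := vP 0; rewrite eqxx.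
have vU w : w != 0 -> isunit A (w ^+ M / pi ^ v w).
  by move=> w0; have := vP w; rewrite (negPf w0).
have vE w s : w != 0 -> isunit A (w ^+ M / pi ^ s) -> v w = s.
  move=> w0 us; have := isunitM AV (isunitV (vU w w0)) us.
  rewrite invf_div mulrA divfK ?expf_neq0 // invr_expz -expfzDr // => /upow.
  by lia.
have ps s : pi ^ s != 0 by rewrite expfz_neq0.
have vM (x y : F) : x != 0 -> y != 0 -> v (x * y) = v x + v y.
  move=> x0 y0; apply: vE; first by rewrite mulf_neq0.
  have := isunitM AV (vU x x0) (vU y y0).
  by rewrite mulf_div -exprMn -expfzDr.
have vA w : A w -> 0 <= v w.
  move=> Aw; have [->|w0] := eqVneq w 0; first by rewrite v0.
  (* For [v w < 0] the inverse of [pi] would be a product of [w ^+ M], a unit and a nonnegative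
     power of [pi]. *)
  rewrite leNgt; apply/negP => vn; apply: nApi.
  have [_ _ Au] := vU w w0; rewrite invf_div in Au.
  have -> : pi^-1 = w ^+ M * (pi ^ v w / w ^+ M) * pi ^+ (`|v w|.-1).
    rewrite [w ^+ M * _]mulrC divfK ?expf_neq0 // exprnP -expfzDr //.
    by rewrite (_ : v w + `|v w|.-1%:Z = -1) //; lia.
  by apply: subringM; [|apply: subringM => //|]; rewrite //; apply: subringX.
have vV x : v x^-1 = - v x.
  have [->|x0] := eqVneq x 0; first by rewrite invr0 v0.
  have xV0 : x^-1 != 0 by rewrite invr_eq0.
  have v1 : v 1 = 0 by apply: vE; rewrite ?oner_neq0 // expr1n expr0z divr1; exact: isunit1.
  by have := vM _ _ x0 xV0; rewrite mulfV // v1; lia.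
have valv : valuation v.
  split=> // x y x0 y0 xy0; rewrite ge_min.
  have half (a b : F) : a != 0 -> b != 0 -> a + b != 0 -> A (a / b) -> v b <= v (a + b).
    move=> a0 b0 ab0 Aab; have Aab1 := vA _ (subringD AP Aab (subring1 AP)).
    have ab1 : a / b + 1 != 0.
      by apply: contraNneq ab0 => E; rewrite -(divfK b0 a) -[X in _ + X]mul1r -mulrDl E mul0r.
    have -> : a + b = (a / b + 1) * b by rewrite mulrDl divfK // mul1r.
    by rewrite vM // lerDr.
  have xy : x / y != 0 by rewrite mulf_neq0 ?invr_eq0.
  have [Axy|] := AV.2 _ xy; first by rewrite (half x y) ?orbT.
  by rewrite invf_div => Ayx; rewrite addrC (half y x) // addrC.
have z0 : z != 0 by apply/eqP => zz; apply: Az; rewrite zz; exact: subring0 AP.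
have vz : v z < 0.
  have [/Az //|Az'] := AV.2 z z0.
  have := vA _ Az'; rewrite vV oppr_ge0 le_eqVlt => /orP[/eqP vz0|//].
  have := vU z z0; rewrite vz0 expr0z divr1 => /(isunitX_inv AV M0).
  by case=> _ /Az.
(* The exponent [v] need not take the value 1. *)
have [|e [w [e0 [w0 wM wD] wu wE]]] := valuation_normalize valv.
  by exists z; rewrite lt_eqF.
have wA u : A u -> 0 <= w u by move=> /vA; rewrite wE pmulr_rge0.
have wK (c : K) : c != 0 -> w (ext_const F c) = 0.
  move=> c0; have [_ Ac Ac'] := unit_const c0.
  have := wA _ Ac; have := wA _ Ac'.
  by rewrite (valV (And3 w0 wM wD)) -[polyF _]/(ext_const F c); lia.
exists (Place w0 wM wD wK wu); split=> //=.
by move: vz; rewrite wE pmulr_rlt0.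
Qed.

End WithRing.

Lemma exists_place (R : F -> Prop) z : subring R ->
  (forall c : K, R (polyF c%:P)) -> z != 0 -> R z^-1 -> ~ R z ->
  exists v : place (ext_const F), (forall w, R w -> 0 <= v w) /\ v z < 0.
Proof.
move=> RP RK z0 Rz' Rz; have [A [AV sRA Az]] := exists_valuation_ring RP z0 Rz' Rz.
have [v [vA vz]] := place_of_ring AV (fun c => sRA _ (RK c)) Az.
by exists v; split=> // w /sRA/vA.
Qed.

End PlaceOfRing.

(** * Places of the rational function field *)

Section RationalPlaces.

Variables (K k : fieldType) (io : {rmorphism {poly K} -> k}).
Hypothesis io_inj : injective io.
Hypothesis io_frac : forall a : k, exists g h, h != 0 /\ a = io g / io h.
Implicit Types (a b : K) (g h : {poly K}) (p : k -> int).

(* Places of [K(x)], for [k] any field of fractions of [K[x]]. *)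
Definition rat_place p : Prop :=
  [/\ valuation p, exists z, p z = 1 & forall c, c != 0 -> p (io c%:P) = 0].

Lemma io_eq0 g : (io g == 0) = (g == 0).
Proof. by rewrite -(inj_eq io_inj) rmorph0. Qed.

Lemma io_XsubC a : io ('X - a%:P) != 0.
Proof. by rewrite io_eq0 polyXsubC_eq0. Qed.

Section Fix.

Variables (p : k -> int) (pP : rat_place p).

Let pV : valuation p. Proof. by case: pP. Qed.

Lemma val_const c : c != 0 -> p (io c%:P) = 0.
Proof. by case: pP => _ _; apply. Qed.

Lemma vge_const c : vge p 0 (io c%:P).
Proof.
have [->|c0] := eqVneq c 0; first by rewrite rmorph0 vge0.
by rewrite vge00 // val_const.
Qed.

Lemma io_coef g : io g = \sum_(i < size g) io (g`_i)%:P * io 'X ^+ i.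
Proof.
rewrite -[in LHS](coefK g) poly_def rmorph_sum; apply: eq_bigr => i _.
by rewrite -mul_polyC rmorphM rmorphXn.
Qed.

Lemma val_poly_ge0 g : 0 <= p (io 'X) -> 0 <= p (io g).
Proof.
move=> pX; rewrite -vge00 // io_coef; apply: vge_sum => // i _.
apply: vgeM0 => //; first exact: vge_const.
by rewrite vge00 // valX // mulr_ge0.
Qed.

(** A common divisor of the values of polynomials divides the values of all fractions, among them
    1. *)
Lemma rat_place_unif (s : int) : 0 < s ->
  (forall g, g != 0 -> exists j : int, p (io g) = s * j) -> s = 1.
Proof.
move=> s0 H; have [_ [z pz] _] := pP.
have z0 : z != 0 by apply/eqP => z0; move: pz; rewrite z0 val0.
have [g [h [h0 zE]]] := io_frac z.
have g0 : g != 0.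
  by apply: contraNneq z0 => g0; rewrite zE g0 rmorph0 mul0r.
have [i iE] := H g g0; have [j jE] := H h h0.
have : (s %| 1)%Z.
  apply/dvdzP; exists (i - j).
  by move: pz; rewrite zE val_div ?io_eq0 // iE jE; lia.
by rewrite dvdz1; lia.
Qed.

Section Finite.

Variables (a : K) (pa : 0 < p (io ('X - a%:P))).

Lemma val_X_ge0 : 0 <= p (io 'X).
Proof.
rewrite -vge00 // -['X](subrK a%:P) rmorphD; apply: vgeD => //.
  by rewrite vge00 // ltW.
exact: vge_const.
Qed.

Lemma val_nonroot g : ~~ root g a -> p (io g) = 0.
Proof.
rewrite /root => ga.
have /factor_theorem[q qE] : root (g - g.[a]%:P) a by rewrite /root !hornerE subrr.
have -> : io g = io g.[a]%:P + io q * io ('X - a%:P).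
  by rewrite -rmorphM -qE -rmorphD addrC subrK.
have [||_ ->] := @val_addl _ p pV (io g.[a]%:P) (io q * io ('X - a%:P)).
- by rewrite io_eq0 polyC_eq0.
- rewrite val_const //; apply: vgeM => //; last by rewrite vge_neq0 ?io_XsubC //; lia.
  by rewrite vge00 // val_poly_ge0 // val_X_ge0.
- exact: val_const.
Qed.

Lemma val_mul_XsubC g : g != 0 ->
  exists2 n : nat, p (io g) = p (io ('X - a%:P)) * n%:Z & exists2 h, ~~ root h a & g = h * ('X - a%:P) ^+ n.
Proof.
move=> g0; have [n [h ha gE]] := multiplicity_XsubC g a.
rewrite g0 /= in ha; exists n; last by exists h.
have h0 : io h != 0 by rewrite io_eq0; apply: contraNneq ha => ->; rewrite root0.
rewrite gE rmorphM rmorphXn (valM pV) ?expf_neq0 ?io_XsubC //.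
by rewrite (val_nonroot ha) (valX pV) add0r mulrC.
Qed.

Lemma val_XsubC_unif : p (io ('X - a%:P)) = 1.
Proof.
by apply: rat_place_unif => // g /val_mul_XsubC[n pn _]; exists n.
Qed.

Lemma val_XsubC b : p (io ('X - b%:P)) = (b == a)%:Z.
Proof.
have [->|ba] := eqVneq b a; first exact: val_XsubC_unif.
by rewrite val_nonroot // root_XsubC eq_sym.
Qed.

End Finite.

Section Infinite.

Hypothesis pX : p (io 'X) < 0.

Lemma val_infty_mul g : g != 0 -> p (io g) = p (io 'X) * (size g).-1%:Z.
Proof.
move=> g0; have X0 : io 'X != 0 by rewrite io_eq0 polyX_eq0.
have sg : size g = (size g).-1.+1 by rewrite prednK // lt0n size_poly_eq0.
rewrite io_coef sg big_ord_recr /= addrC.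
have l0 : g`_(size g).-1 != 0 by rewrite -lead_coefE lead_coef_eq0.
have lE : p (io (g`_(size g).-1)%:P * io 'X ^+ (size g).-1) = p (io 'X) * (size g).-1%:Z.
  rewrite valM ?expf_neq0 ?io_eq0 ?polyC_eq0 ?polyX_eq0 // val_const //.
  by rewrite valX // add0r mulrC.
have [||_ ->] := @val_addl _ p pV (io (g`_(size g).-1)%:P * io 'X ^+ (size g).-1)
   (\sum_(i < (size g).-1) io (g`_i)%:P * io 'X ^+ i).
- by rewrite mulf_neq0 ?expf_neq0 // io_eq0 polyC_eq0.
- rewrite lE; apply: vge_sum => // i _.
  apply: (@vge_le _ _ _ (0 + i%:Z * p (io 'X))).
    by have := ltn_ord i; move: (p _) (size g).-1 (i : nat) pX => v s j; nia.
  apply: vgeM => //; first exact: vge_const.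
  by rewrite vge_neq0 ?expf_neq0 // valX.
- exact: lE.
Qed.

Lemma val_infty_X : p (io 'X) = -1.
Proof.
have := @rat_place_unif (- p (io 'X)).
have -> : (- p (io 'X) = 1) <-> (p (io 'X) = -1) by split; lia.
apply; first by lia.
by move=> g g0; exists (- (size g).-1%:Z); rewrite val_infty_mul // mulrNN.
Qed.

Lemma val_infty g : g != 0 -> p (io g) = - (size g).-1%:Z.
Proof. by move=> g0; rewrite val_infty_mul // val_infty_X mulN1r. Qed.

End Infinite.

(** Splitting forces the finite zeros of [f] to be rational: if all linear polynomials had value 0,
    so would [f]. *)
Lemma val_split_zero f : f != 0 -> (exists s : seq K, f %= \prod_(a <- s) ('X - a%:P)) ->
  0 <= p (io 'X) -> p (io f) != 0 -> exists a, 0 < p (io ('X - a%:P)).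
Proof.
move=> f0 [s /eqpP[[c1 c2] /= /andP[c10 c20] E]] pX pf.
apply: boolp.contrapT => H.
have p0 a : p (io ('X - a%:P)) = 0.
  have := val_poly_ge0 ('X - a%:P) pX; rewrite le_eqVlt => /orP[/eqP//|pos].
  by case: H; exists a.
move/eqP: pf; apply.
have := congr1 (fun g => p (io g)) E.
have [P0 pP0] : \prod_(b <- s) ('X - b%:P) != 0 /\
    p (io (\prod_(b <- s) ('X - b%:P))) = 0.
  elim: s {E} => [|b s [P0 pP0]]; first by rewrite big_nil rmorph1 val1 // oner_neq0.
  rewrite big_cons mulf_neq0 ?polyXsubC_eq0 //; split=> //.
  by rewrite rmorphM valM ?io_eq0 ?polyXsubC_eq0 // p0 pP0.
by rewrite -!mul_polyC !rmorphM !valM ?io_eq0 ?polyC_eq0 // !val_const // pP0 add0r.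
Qed.

End Fix.

Lemma rat_place_eq p p' : rat_place p -> rat_place p' ->
  (forall g, g != 0 -> p (io g) = p' (io g)) -> p =1 p'.
Proof.
move=> [pV _ _] [pV' _ _] E z; have [g [h [h0 ->]]] := io_frac z.
have [->|g0] := eqVneq g 0; first by rewrite rmorph0 mul0r !val0.
by rewrite !val_div ?io_eq0 // !E.
Qed.

Lemma rat_place_eq_finite a p p' : rat_place p -> rat_place p' ->
  0 < p (io ('X - a%:P)) -> 0 < p' (io ('X - a%:P)) -> p =1 p'.
Proof.
move=> pP pP' pa pa'; apply: rat_place_eq => // g g0.
have [n -> [h ha gE]] := val_mul_XsubC pP pa g0; have [pV' _ _] := pP'.
have h0 : h != 0 by apply: contraNneq ha => ->; rewrite root0.
rewrite gE rmorphM (valM pV') ?io_eq0 ?expf_neq0 ?polyXsubC_eq0 //.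
rewrite (val_nonroot pP' pa' ha) rmorphXn (valX pV').
by rewrite (val_XsubC_unif pP pa) (val_XsubC_unif pP' pa') mul1r mulr1 add0r.
Qed.

Lemma rat_place_eq_infty p p' : rat_place p -> rat_place p' ->
  p (io 'X) < 0 -> p' (io 'X) < 0 -> p =1 p'.
Proof.
move=> pP pP' pX pX'; apply: rat_place_eq => // g g0.
by rewrite (val_infty pP pX g0) (val_infty pP' pX' g0).
Qed.

End RationalPlaces.

(** * Totally ramified Kummer extensions *)

Section TotalRamification.

Variables (k : fieldType) (F : fieldExtType k).
Variables (P : k -> int) (Q : F -> int) (e : nat).
Hypotheses (PV : valuation P) (QV : valuation Q).
Hypothesis QP : forall a, Q a%:A = e%:Z * P a.
Hypothesis e_gt0 : (0 < e)%N.
Implicit Types (a b u : k) (w x y z : F).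

Lemma alg_eq0 a : (a%:A == 0 :> F) = (a == 0).
Proof. by rewrite -in_algE fmorph_eq0. Qed.

Lemma algX a n : (a ^+ n)%:A = a%:A ^+ n :> F.
Proof. by rewrite -!in_algE rmorphXn. Qed.

Lemma val_scale a x : a != 0 -> x != 0 -> Q (a *: x) = e%:Z * P a + Q x.
Proof. by move=> a0 x0; rewrite -mulr_algl valM ?alg_eq0 // QP. Qed.

Section Independent.

Variables (n : nat) (x : 'I_n -> F).
Hypothesis x_neq0 : forall i, x i != 0.
Hypothesis x_distinct : forall i j, (e%:Z %| Q (x i) - Q (x j))%Z -> i = j.

(** Coefficients from the base change values by multiples of [e] only, so the terms keep distinct
    classes and [val_sum_distinct] applies. *)
Lemma ram_sum (c : 'I_n -> k) i0 : c i0 != 0 ->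
  \sum_i c i *: x i != 0 /\
  exists i, [/\ c i != 0, Q (\sum_j c j *: x j) = e%:Z * P (c i) + Q (x i)
    & forall j, c j != 0 -> e%:Z * P (c i) + Q (x i) <= e%:Z * P (c j) + Q (x j)].
Proof.
have c0 i : (c i *: x i != 0) = (c i != 0).
  by rewrite scaler_eq0 negb_or x_neq0 andbT.
rewrite -c0 => ci0.
have [|s0 [i [ci QE imin]]] := @val_sum_distinct _ _ QV _ (fun i => c i *: x i) i0 ci0.
  move=> i j; rewrite !c0 => ci cj; rewrite !val_scale // => E.
  by apply: x_distinct; apply/dvdzP; exists (P (c j) - P (c i)); lia.
split=> //; exists i; move: ci; rewrite c0 => ci.
split=> // [|j cj]; first by rewrite QE val_scale.
by have := imin j; rewrite vge_neq0 ?c0 // !val_scale.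
Qed.

Lemma ram_basis w : n = \dim {:F} -> exists c : 'I_n -> k, w = \sum_i c i *: x i.
Proof.
move=> nE; pose X := [tuple x i | i < n].
have fX : free X.
  apply/freeP => c Xc i; apply: boolp.contrapT => /eqP ci.
  have [+ _] := ram_sum ci; rewrite (eq_bigr (fun j => c j *: X`_j)) ?Xc ?eqxx //.
  by move=> j _; rewrite -tnth_nth tnth_mktuple.
have bX : basis_of {:F} X by rewrite basisEfree fX subvf size_tuple nE leqnn.
exists (fun i => coord X i w); rewrite {1}(coord_basis bX (memvf w)).
by apply: eq_bigr => i _; rewrite -tnth_nth tnth_mktuple.
Qed.

End Independent.

Hypothesis eE : e = \dim {:F}.
Hypothesis Q_unif : exists z, Q z = 1.

(* A [d]-th root of an element of the base field differs from a base element
   [a] by a term [s] of value prime to [e], and [Q (w ^ d - a ^ d) = Q s]. *)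
Lemma ram_unit_root d u w : P d%:R = 0 -> d%:R != 0 :> k ->
  w ^+ d = u%:A -> w != 0 -> Q w = 0 -> exists a, w = a%:A.
Proof.
move=> Pd d0 wd w0 Qw; have [tau Qtau] := Q_unif.
have tau0 : tau != 0 by apply/eqP => t0; move: Qtau; rewrite t0 val0.
have [||c wE] := @ram_basis e (fun i => tau ^+ i) _ _ w eE.
- by move=> i; rewrite expf_neq0.
- move=> i j; rewrite !valX // Qtau !mulr1 -eqz_mod_dvd.
  by rewrite !modz_small ?ltz_nat ?ltn_ord //= => /eqP[] /ord_inj.
pose o := Ordinal e_gt0.
pose s := \sum_(i | i != o) c i *: tau ^+ i.
have {wE} wE : w = (c o)%:A + s by rewrite wE (bigD1 o) //= expr0.
(* Without the constant term, the least value is congruent to some [j] with [0 < j < e]. *)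
have Qs : s != 0 -> ~~ (e%:Z %| Q s)%Z.
  pose c' i := if i == o then 0 else c i.
  have sE : s = \sum_i c' i *: tau ^+ i.
    rewrite [RHS](bigD1 o) //= /c' eqxx scale0r add0r; apply: eq_bigr => i io.
    by rewrite (negPf io).
  rewrite sE => s0; have [i ci] : exists i, c' i != 0.
    apply: boolp.contrapT => H; case/eqP: s0; apply: big1 => i _.
    have [->|ci] := eqVneq (c' i) 0; first by rewrite scale0r.
    by case: H; exists i.
  have [||_ [j [+ -> _]]] := @ram_sum _ (fun i => tau ^+ i) _ _ c' i ci.
  - by move=> l; rewrite expf_neq0.
  - move=> l l'; rewrite !valX // Qtau !mulr1 -eqz_mod_dvd.
    by rewrite !modz_small ?ltz_nat ?ltn_ord //= => /eqP[] /ord_inj.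
  rewrite /c'; have [_|jo _] := eqVneq j o; first by rewrite eqxx.
  rewrite valX // Qtau mulr1 rpredDl ?dvdz_mulr // ?dvdzz //.
  have j0 : (0 < j)%N by rewrite lt0n; apply: contraNneq jo => j0; apply/eqP/ord_inj.
  by rewrite dvdzE /=; apply/negP => /(dvdn_leq j0); rewrite leqNgt ltn_ord.
have [s0|s0] := eqVneq s 0; first by exists (c o); rewrite wE s0 addr0.
have {}Qs := Qs s0; set a := c o in wE.
have Qs0 : Q s != 0 by apply: contraNneq Qs => ->; rewrite dvdz0.
have a0 : a != 0.
  by apply: contraNneq Qs0 => a0; rewrite -Qw wE a0 scale0r add0r.
have A0 : a%:A != 0 :> F by rewrite alg_eq0.
(* Only the first of [Q a%:A], [Q s] is divisible by [e], so they differ and the smaller one is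
   [Q w = 0]. *)
have [QA Qs_gt0] : Q a%:A = 0 /\ 0 < Q s.
  have [lt|lt|E] := ltrgtP (Q a%:A) (Q s).
  - have [||_] := @val_addl _ _ QV a%:A s => //; first by rewrite vge_neq0 // lezD1.
    by rewrite -wE Qw => QA; split; [rewrite QA | rewrite [0]QA].
  - have [||_] := @val_addl _ _ QV s a%:A => //; first by rewrite vge_neq0 // lezD1.
    by rewrite addrC -wE Qw => Qs1; case/eqP: Qs0; rewrite Qs1.
  - by case/negP: Qs; rewrite -E QP dvdz_mulr.
have d_gt0 : (0 < d)%N by case: (d) d0 => //; rewrite eqxx.
have vw i : vge Q 0 (w ^+ i) by rewrite vge00 // valX // Qw mulr0.
have vA i : vge Q 0 (a%:A ^+ i) by rewrite vge00 // valX // QA mulr0.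
have vs i : vge Q 1 (w ^+ i - a%:A ^+ i).
  rewrite subrXX {1}wE addrC addKr -[1]addr0; apply: vgeM => //.
    by rewrite vge_neq0 //; lia.
  by apply: vge_sum => // j _; apply: vgeM0.
(* Since [w] and [a] are congruent modulo positive values, [G] is congruent to [d * a ^ (d - 1)],
   which has value 0 because [d] is a nonzero constant. *)
set G := \sum_(i < d) w ^+ (d.-1 - i) * a%:A ^+ i.
have GE : w ^+ d - a%:A ^+ d = s * G by rewrite subrXX {1}wE addrC addKr.
have H0 : d%:R * a%:A ^+ d.-1 != 0 :> F.
  rewrite mulf_neq0 ?expf_neq0 //.
  by have := d0; rewrite -alg_eq0 scaler_nat.
have QH : Q (d%:R * a%:A ^+ d.-1) = 0.
  have dE : d%:R = (d%:R)%:A :> F by rewrite scaler_nat.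
  by rewrite valM ?expf_neq0 ?dE ?alg_eq0 // QP Pd valX // QA !mulr0.
have [||G0 QG] := @val_addl _ _ QV (d%:R * a%:A ^+ d.-1) (G - d%:R * a%:A ^+ d.-1) => //.
  rewrite QH mulr_natl -[X in _ - _ *+ X]card_ord -sumr_const -sumrB.
  apply: vge_sum => // i _; rewrite add0r.
  have id : (i <= d.-1)%N by have := ltn_ord i; lia.
  rewrite -{2}(subnK id) exprD -mulrBl -[1]addr0.
  by apply: vgeM.
rewrite addrC subrK in G0 QG; rewrite QH in QG.
have : Q (w ^+ d - a%:A ^+ d) = Q s by rewrite GE valM // QG addr0.
rewrite wd -algX -scalerBl QP => Qs1.
by case/negP: Qs; rewrite -Qs1 dvdz_mulr.
Qed.

(** Let [d] be the gcd and [P phi = l * d]. Then [y ^ (m / d) / pi ^ l] has value 0 and its [d]-th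
    power is in the base field, so it is itself in the base field by [ram_unit_root]. For [d > 1]
    this makes [phi] a forbidden [d]-th power. *)
Lemma ram_kummer_coprime (pi : k) (y : F) (phi : k) m : P pi = 1 -> phi != 0 ->
  y ^+ m = phi%:A -> (0 < m)%N ->
  (forall d, (d %| m)%N -> P d%:R = 0 /\ d%:R != 0 :> k) ->
  (forall d, (1 < d)%N -> (d %| m)%N -> ~ exists g, phi = g ^+ d) ->
  coprime m `|P phi|.
Proof.
move=> Ppi phi0 ym m0 md npow; rewrite /coprime.
have pi0 : pi != 0 by apply/eqP => pi0; move: Ppi; rewrite pi0 val0.
have d0 : (0 < gcdn m `|P phi|)%N by rewrite gcdn_gt0 m0.
rewrite eqn_leq d0 andbT leqNgt; apply/negP => d1.
have dm := dvdn_gcdl m `|P phi|; have dP := dvdn_gcdr m `|P phi|.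
set d := gcdn _ _ in d0 d1 dm dP.
have {dP} /dvdzP[l lE] : (d%:Z %| P phi)%Z by rewrite dvdzE.
have /dvdnP[m' mE] := dm.
have [Pd dk] := md d dm.
have y0 : y != 0.
  apply/eqP => y0; move/eqP: ym.
  by rewrite y0 expr0n eqn0Ngt m0 eq_sym alg_eq0 (negPf phi0).
have pl0 : pi ^ l != 0 by rewrite expfz_neq0.
set w := y ^+ m' / (pi ^ l)%:A.
have wd : w ^+ d = (phi / (pi ^ l) ^+ d)%:A.
  by rewrite /w expr_div_n -exprM -mE ym -algX alg_div.
have w0 : w != 0 by rewrite mulf_neq0 ?invr_eq0 ?expf_neq0 ?alg_eq0.
have Qw : Q w = 0.
  have : Q (w ^+ d) = 0.
    by rewrite wd QP val_div ?expf_neq0 // valX // valXz // Ppi lE; lia.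
  by rewrite valX // => /eqP; rewrite mulf_eq0 => /orP[/eqP|/eqP//]; lia.
have [a wa] := ram_unit_root Pd dk wd w0 Qw.
apply: (npow d d1 dm); exists (a * pi ^ l).
move: wd; rewrite wa -algX => /(@fmorph_inj _ _ (in_alg F)) E.
by rewrite exprMn E divfK ?expf_neq0.
Qed.

(** The equation [m * Q y = e * P phi] and coprimality give that [m] divides [e]; the minimal
    polynomial of [y] divides [X^m - phi], so [e <= m]. *)
Lemma ram_kummer_dim (y : F) (phi : k) m : phi != 0 ->
  y ^+ m = phi%:A -> (0 < m)%N -> <<1; y>>%VS = {:F}%VS ->
  coprime m `|P phi| -> e = m /\ Q y = P phi.
Proof.
move=> phi0 ym m0 ygen cop.
have QE : m%:Z * Q y = e%:Z * P phi by rewrite -valX // ym QP.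
have me : (m %| e)%N.
  rewrite -(Gauss_dvdl _ cop).
  have : (m%:Z %| e%:Z * P phi)%Z by rewrite -QE dvdz_mulr.
  by rewrite dvdzE abszM.
have em : (e <= m)%N.
  rewrite eE -ygen dim_Fadjoin dimv1 muln1 -ltnS -size_minPoly.
  have szp : size ('X^m - (phi%:A)%:P : {poly F}) = m.+1 by rewrite size_XnsubC.
  rewrite -szp; apply: dvdp_leq; first by rewrite -size_poly_eq0 szp.
  apply: minPoly_dvdp.
    rewrite rpredB ?rpredX ?polyOverX // polyOverC.
    by rewrite memvZ // mem1v.
  by rewrite /root !hornerE ym subrr.
have E : e = m by apply/eqP; rewrite eqn_leq em dvdn_leq.
split=> //; move: QE; rewrite E => /mulfI; apply; lia.
Qed.

End TotalRamification.

(** * Coordinates of integral elements *)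

Section KummerIntegral.

Variables (k : fieldType) (F : fieldExtType k).
Variables (y : F) (phi : k) (m p0 : nat) (p : k -> int).
Hypotheses (m_gt1 : (1 < m)%N) (ym : y ^+ m = phi%:A).
Hypotheses (p0_char : p0 \in [pchar k]) (p0_m : coprime p0 m).
Hypothesis y_span : forall z, exists c : 'I_m -> k, z = \sum_t c t *: y ^+ t.
Hypothesis y_free : forall c : 'I_m -> k,
  \sum_t c t *: y ^+ t = 0 -> forall t, c t = 0.
Hypotheses (pV : valuation p) (phi0 : phi != 0).

Lemma kummer_coord_uniq (c c' : 'I_m -> k) :
  \sum_t c t *: y ^+ t = \sum_t c' t *: y ^+ t -> c =1 c'.
Proof.
move=> E t; apply/eqP; rewrite -subr_eq0; apply/eqP.
apply: (y_free (c := fun t => c t - c' t)).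
by rewrite (eq_bigr _ (fun t _ => scalerBl _ _ _)) sumrB E subrr.
Qed.

Lemma exprN_sum (I : Type) (r : seq I) (E : I -> F) (n : nat) :
  (\sum_(i <- r) E i) ^+ (p0 ^ n) = \sum_(i <- r) E i ^+ (p0 ^ n).
Proof.
have Fp0 : p0 \in [pchar F] by rewrite pchar_lalg.
have p0P : prime p0 by case/andP: p0_char.
apply: (big_morph (fun x => x ^+ (p0 ^ n))).
  move=> a b; apply: exprDn_pchar.
  by rewrite (eq_pnat _ (pcharf_eq Fp0)) pnatX pnat_id.
by rewrite expr0n eqn0Ngt expn_gt0 prime_gt0.
Qed.

(* For [N] a power of the characteristic with [N = m l + 1] the coordinates of
   [z ^ N] are [c_t ^ N * phi ^ (t l)], while integrality bounds the
   coordinates of all powers of [z] from below. *)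
Lemma kummer_integral z (d : nat) (g : 'I_d -> k) (c : 'I_m -> k) t :
  (forall i, vge p 0 (g i)) -> z ^+ d = \sum_i g i *: z ^+ i ->
  z = \sum_t c t *: y ^+ t -> c t != 0 ->
  0 <= m%:Z * p (c t) + t%:Z * p phi.
Proof.
move=> gP zd zE ct.
have /boolp.choice[C CE] j := y_span (z ^+ j).
pose B : int := - \sum_(i < d) \sum_s `|p (C i s)|.
(* [B] bounds the coordinates of the first [d] powers; the integral equation has coefficients of
   nonnegative value, so it passes the same bound on to higher powers. *)
have BP j s : vge p B (C j s).
  have [n] := ubnP j; elim: n j s => // n IHn j s jn.
  have [jd|dj] := ltnP j d.
    rewrite /vge; apply/orP; right; rewrite /B.
    have := ler_norm (- p (C j s)); rewrite normrN.
    suff : `|p (C j s)| <= \sum_(i < d) \sum_s `|p (C i s)| by lia.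
    rewrite (bigD1 (Ordinal jd)) //= (bigD1 s) //= -addrA lerDl.
    by apply: addr_ge0; [|apply: sumr_ge0 => i _]; apply: sumr_ge0 => i' _.
  have CjE : C j =1 (fun s => \sum_i g i * C (j - d + i)%N s).
    apply: kummer_coord_uniq; rewrite -CE -{1}(subnK dj) exprD zd mulr_sumr.
    rewrite (eq_bigr (fun i => \sum_t (g i * C (j - d + i)%N t) *: y ^+ t)).
      by rewrite exchange_big /=; apply: eq_bigr => t' _; rewrite scaler_suml.
    move=> i _; rewrite -scalerAr -exprD CE scaler_sumr.
    by apply: eq_bigr => t' _; rewrite scalerA.
  rewrite CjE; apply: vge_sum => // i _; rewrite -[B]add0r.
  by apply: vgeM => //; apply: IHn; have := ltn_ord i; lia.
(* A negative [m * p (c t) + t * p phi] would be multiplied by [N] and fall below the bound once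
   [N > J]. The factor [totient m] in the exponent makes [N] congruent to 1 modulo [m]. *)
pose J := (absz (m%:Z * B) + absz (t%:Z * p phi)).+1.
pose n := (totient m * J)%N; set N := (p0 ^ n)%N.
have p0_gt1 : (1 < p0)%N by apply: prime_gt1; case/andP: p0_char.
have JN : (J < N)%N.
  apply: (leq_trans (ltn_expl J p0_gt1)); rewrite leq_exp2l //.
  by rewrite /n leq_pmull // totient_gt0 ltnW.
have [l NE] : exists l, N = (l * m + 1)%N.
  exists (N %/ m)%N; rewrite {1}(divn_eq N m); congr (_ + _)%N.
  by rewrite /N /n expnM -modnXm Euler_exp_totient // modnXm exp1n modn_small.
have CN : C N =1 (fun s => c s ^+ N * phi ^+ (l * s)).
  apply: kummer_coord_uniq; rewrite -CE {1}zE exprN_sum; apply: eq_bigr => s _.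
  rewrite -/N exprZn -scalerA; congr (_ *: _).
  rewrite -exprM NE mulnDr muln1 exprD mulnC mulnAC mulnC exprM ym -algX.
  by rewrite mulr_algl.
have := BP N t; rewrite CN vge_neq0 ?mulf_neq0 ?expf_neq0 //.
rewrite valM ?expf_neq0 // !valX // => BN; rewrite leNgt; apply/negP => W0.
have mN : m%:Z * l%:Z = N%:Z - 1 by rewrite NE; lia.
have : m%:Z * B <= N%:Z * (m%:Z * p (c t) + t%:Z * p phi) - t%:Z * p phi.
  have -> : N%:Z * (m%:Z * p (c t) + t%:Z * p phi) - t%:Z * p phi =
      m%:Z * (N%:Z * p (c t) + (l * t)%N%:Z * p phi).
    rewrite PoszM.
    transitivity (N%:Z * (m%:Z * p (c t)) + (N%:Z - 1) * (t%:Z * p phi)); first by ring.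
    by rewrite -mN; ring.
  by rewrite ler_wpM2l.
move: JN W0; rewrite /J; move: (m%:Z * B) (t%:Z * p phi) (m%:Z * p (c t)) => X T Y.
move=> JN W0 H; have : N%:Z * (Y + T) <= - N%:Z by nia.
by lia.
Qed.

End KummerIntegral.

(** * Maximal elements of the semigroup *)

Section RoundedDivision.

Variables (m : nat) (m_gt0 : (0 < m)%N).
Implicit Types a b c : int.

Let m_neq0 : m%:R != 0 :> rat. Proof. by rewrite pnatr_eq0 -lt0n. Qed.

Lemma ceil_div_le a b : a <= b -> ceil_div a m <= ceil_div b m.
Proof.
move=> ab; apply: le_ceil.
by rewrite ler_pM2r ?invr_gt0 ?ltr0n // ler_int.
Qed.

Lemma ceil_div_addM a c : ceil_div (a + c * m%:Z) m = ceil_div a m + c.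
Proof.
rewrite /ceil_div; have -> : (a + c * m%:Z)%:~R / m%:R = a%:~R / m%:R + c%:~R :> rat.
  by rewrite intrD intrM mulrDl mulfK.
by rewrite ceilDrz ?intr_int // intrKceil.
Qed.

Lemma ceil_divN a : ceil_div (- a) m = - floor_div a m.
Proof. by rewrite /ceil_div /floor_div mulrNz mulNr ceilNfloor opprK. Qed.

(** With [a = t * lambda], this is the least value [c] of a coefficient for which its product with
    [y ^ t] is regular. *)
Lemma floor_div_leP a c : (- floor_div a m <= c) = (0 <= m%:Z * c + a).
Proof.
rewrite -ceil_divN /ceil_div ceil_le_int ler_pdivrMr ?ltr0n //.
by rewrite -[m%:R]/((m%:Z)%:~R) -intrM ler_int; lia.
Qed.

End RoundedDivision.

(** * Classes modulo m and the two kinds of maximal elements *)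

Section Combinatorics.

Variables (K F : fieldType) (i : {rmorphism K -> F}) (m n : nat).
Variables (Q : 'I_n -> place i) (lambda : 'I_n -> int) (A : 'I_m -> int).
Hypotheses (m_gt0 : (0 < m)%N) (n_ge2 : (2 <= n)%N).
Hypothesis lambda_m : forall k, coprime m `|lambda k|.
Implicit Types (alpha beta gamma : 'I_n -> int) (t : 'I_m) (D J : {set 'I_n}).

Definition in_class t alpha : Prop :=
  forall k, (m%:Z %| alpha k + t%:Z * lambda k)%Z.

Definition class_sum t alpha : int := \sum_(k < n) ceil_div (alpha k) m + A t.

(** These two hypotheses carry the input from the function field: vectors of one class that are
    realized by functions, and the decomposition of any element of the semigroup into such
    vectors. *)
Hypothesis gen_of_class : forall t alpha,
  in_class t alpha -> 0 <= class_sum t alpha -> gen_semigroup Q alpha.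
Hypothesis class_of_gen : forall alpha, gen_semigroup Q alpha ->
  forall k, exists t gamma, [/\ in_class t gamma, 0 <= class_sum t gamma,
    forall l, gamma l <= alpha l & gamma k = alpha k].

(** [lambda k] is invertible modulo [m], so a single coordinate determines the class. *)
Lemma class_uniq t t' k (a : int) : (m%:Z %| a + t%:Z * lambda k)%Z ->
  (m%:Z %| a + t'%:Z * lambda k)%Z -> t = t'.
Proof.
move=> d d'; have := rpredB d d'.
have -> : a + t%:Z * lambda k - (a + t'%:Z * lambda k) = (t%:Z - t'%:Z) * lambda k by ring.
rewrite Gauss_dvdzl; last by rewrite coprimezE.
by rewrite -eqz_mod_dvd !modz_small ?ltz_nat ?ltn_ord //= => /eqP[] /ord_inj.
Qed.

Lemma card_sumz D : #|D|%:Z = \sum_k (k \in D)%:Z.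
Proof.
rewrite -sum1_card big_mkcond (big_morph Posz PoszD (erefl _)).
by apply: eq_bigr => k _; case: (k \in D).
Qed.

(** Within a class coordinates differ by multiples of [m], so each strict drop lowers a ceiling by
    at least 1. *)
Lemma class_sum_drop t alpha gamma D : in_class t alpha -> in_class t gamma ->
  (forall k, gamma k <= alpha k) -> (forall k, k \in D -> gamma k < alpha k) ->
  class_sum t gamma <= class_sum t alpha - #|D|%:Z.
Proof.
move=> ca cg le ltD; rewrite /class_sum addrAC lerD2r card_sumz -sumrB; apply: ler_sum => k _.
case: (boolP (k \in D)) => [kD|_]; last by rewrite subr0 ceil_div_le.
have : (m%:Z %| alpha k - gamma k)%Z.
  have := rpredB (ca k) (cg k).
  by have -> : alpha k + t%:Z * lambda k - (gamma k + t%:Z * lambda k) = alpha k - gamma k by ring.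
move=> /dvdzP[c cE]; have -> : alpha k = gamma k + c * m%:Z by rewrite -cE; ring.
have := ltD k kD; rewrite ceil_div_addM // -subr_gt0 cE.
by rewrite pmulr_lgt0 ?ltz_nat //; lia.
Qed.

(** For [alpha] in a class, this is the largest vector of the same class below [alpha] and strictly
    below it on [D]. *)
Definition lower D alpha : 'I_n -> int :=
  fun k => if k \in D then alpha k - m%:Z else alpha k.

Lemma in_class_lower t alpha D : in_class t alpha -> in_class t (lower D alpha).
Proof.
move=> ca k; rewrite /lower; case: ifP => _ //.
by rewrite addrAC rpredB ?dvdzz.
Qed.

Lemma class_sum_lower t alpha D :
  class_sum t (lower D alpha) = class_sum t alpha - #|D|%:Z.
Proof.
rewrite /class_sum addrAC; congr (_ + _); rewrite card_sumz -sumrB; apply: eq_bigr => k _.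
rewrite /lower; case: ifP => _; last by rewrite subr0.
by rewrite -ceil_div_addM // mulN1r.
Qed.

Lemma nablaJ_lower t alpha J : in_class t alpha ->
  0 <= class_sum t alpha - #|~: J|%:Z -> nablaJ Q J alpha (lower (~: J) alpha).
Proof.
move=> ca s0; split.
- apply: (gen_of_class (t := t)); first exact: in_class_lower.
  by rewrite class_sum_lower.
- by move=> j jJ; rewrite /lower inE jJ.
- by move=> j jJ; rewrite /lower inE jJ; lia.
Qed.

(* The component in the class of [alpha] of an element of [nablaJ J alpha] is
   strictly below [alpha] outside [J]. *)
Lemma nablaJ_class_sum t alpha beta J j : in_class t alpha -> j \in J ->
  nablaJ Q J alpha beta -> #|~: J|%:Z <= class_sum t alpha.
Proof.
move=> ca jJ [gb bJ bnJ]; have [t' [gamma [cg sg le ge]]] := class_of_gen gb j.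
have tt' : t' = t.
  by apply: (@class_uniq _ _ j (alpha j)) => //; rewrite -bJ // -ge; apply: cg.
rewrite tt' in cg sg.
have ba k : beta k <= alpha k.
  by have [/bJ ->//|/bnJ/ltW] := boolP (k \in J).
have := @class_sum_drop t alpha gamma (~: J) ca cg.
have ga k : gamma k <= alpha k by apply: le_trans (le k) (ba k).
move=> /(_ ga)/(_ _)/(le_trans sg); rewrite subr_ge0; apply => k.
by rewrite inE => /bnJ; apply: le_lt_trans.
Qed.

(** Maximality rules out singletons, so absolute maximality can be used for all nonempty proper [J]
    alike. *)
Lemma maximal_nablaJ_card alpha J j : maximal Q alpha -> j \in J ->
  (exists beta, nablaJ Q J alpha beta) -> (2 <= #|J|)%N.
Proof.
move=> [_ nn] jJ [beta b]; rewrite ltnNge; apply/negP => J1; apply: nn.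
exists beta, j; have -> // : [set j] = J.
by apply/eqP; rewrite eqEcard sub1set jJ cards1.
Qed.

Lemma setC_card J : #|~: J|%:Z = n%:Z - #|J|%:Z.
Proof. by have := cardsC J; rewrite card_ord; lia. Qed.

Let k0 : 'I_n := Ordinal (ltnW n_ge2).
Let k1 : 'I_n := Ordinal n_ge2.
Let k01 : k0 != k1. Proof. by []. Qed.

(** A component [gamma] of [alpha] agrees with it on a nonempty set, which must be everything, so
    [alpha] is in one class. A positive sum would allow one coordinate to be lowered. Conversely,
    sum 0 is below [n - |J|] for every proper [J]. *)
Lemma abs_maximal_class alpha :
  abs_maximal Q alpha <-> exists t, in_class t alpha /\ class_sum t alpha = 0.
Proof.
split=> [[amax anJ]|[t [ca sa]]].
  have no J j : j \in J -> J \proper [set: 'I_n] -> ~ exists beta, nablaJ Q J alpha beta.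
    by move=> jJ pJ ex; apply: (anJ J pJ _ ex); exact: maximal_nablaJ_card amax jJ ex.
  have [t [gamma [cg sg le ge]]] := class_of_gen amax.1 k0; exists t.
  pose J := [set k | gamma k == alpha k].
  have JT : J = [set: 'I_n].
    apply: boolp.contrapT => JN; apply: (no J k0); first by rewrite inE ge.
      by rewrite properEneq subsetT andbT; apply/eqP.
    exists gamma; split; first exact: gen_of_class cg sg.
      by move=> j; rewrite inE => /eqP.
    by move=> j; rewrite inE => jN; rewrite lt_neqAle jN le.
  have gE k : gamma k = alpha k by apply/eqP; have := in_setT k; rewrite -JT inE.
  have ca : in_class t alpha by move=> k; rewrite -gE; apply: cg.
  have sE : class_sum t alpha = class_sum t gamma.
    by congr (_ + _); apply: eq_bigr => k _; rewrite gE.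
  split=> //; apply/eqP; rewrite eq_le {2}sE sg andbT leNgt; apply/negP => s1.
  apply: (no (~: [set k1]) k0); first by rewrite !inE.
    by rewrite properEcard subsetT cardsT cardsC1 card_ord ltn_predL ltnW.
  exists (lower (~: ~: [set k1]) alpha); apply: nablaJ_lower ca _.
  by rewrite setCK cards1; lia.
have ga : gen_semigroup Q alpha by apply: gen_of_class ca _; rewrite sa.
have no J j : j \in J -> J \proper [set: 'I_n] -> ~ exists beta, nablaJ Q J alpha beta.
  move=> jJ; rewrite properEcard subsetT cardsT card_ord /= => pJ [beta b].
  by have := nablaJ_class_sum ca jJ b; rewrite sa setC_card subr_le0 lez_nat leqNgt pJ.
split.
  split=> // -[beta [j b]]; apply: (no [set j] j); rewrite ?set11 //; last by exists beta.
  by rewrite properEcard subsetT cardsT card_ord cards1.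
move=> J pJ J2; have [J0|[j jJ]] := set_0Vmem J; last exact: no jJ pJ.
by rewrite J0 cards0 in J2.
Qed.

(** Maximality bounds the sum by [n - 2], since [n - 1] would let all coordinates but one be
    lowered. A pair [J] gives the reverse bound, and the pairs containing [k0] put all coordinates
    in one class. *)
Lemma rel_maximal_class alpha :
  rel_maximal Q alpha <-> exists t, in_class t alpha /\ class_sum t alpha = n%:Z - 2.
Proof.
split=> [[[ga nn] rJ]|[t [ca sa]]].
  have pair k : k != k0 -> exists beta, [/\ gen_semigroup Q beta,
      forall l, l \in [set k0; k] -> beta l = alpha l
      & forall l, l \notin [set k0; k] -> beta l < alpha l].
    (* For [n = 2] the pair is not a proper subset, and [alpha] itself serves. *)
    move=> kk0; have [JT|JN] := eqVneq [set k0; k] [set: 'I_n].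
      by exists alpha; split=> // l; rewrite JT inE.
    by apply: rJ; rewrite ?cards2 1?eq_sym ?kk0 // properEneq JN subsetT.
  have [t [gamma0 [cg0 _ _ ge0]]] := class_of_gen ga k0; exists t.
  have comp k : k != k0 -> exists gamma, [/\ in_class t gamma, 0 <= class_sum t gamma,
      forall l, gamma l <= alpha l, gamma k = alpha k
      & forall l, l \notin [set k0; k] -> gamma l < alpha l].
    move=> kk0; have [beta [gb bJ bnJ]] := pair k kk0.
    have [t' [gamma [cg sg le ge]]] := class_of_gen gb k0.
    have bk0 : beta k0 = alpha k0 by apply: bJ; rewrite !inE eqxx.
    have tt' : t' = t.
      apply: (@class_uniq _ _ k0 (alpha k0)); last by rewrite -ge0; apply: cg0.
      by rewrite -bk0 -ge; apply: cg.
    rewrite tt' in cg sg.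
    have ba l : beta l <= alpha l.
      by have [/bJ ->//|/bnJ/ltW] := boolP (l \in [set k0; k]).
    have gal l : gamma l <= alpha l by apply: le_trans (le l) (ba l).
    have gbl l : l \notin [set k0; k] -> gamma l < alpha l.
      by move=> /bnJ; apply: le_lt_trans.
    (* If [gamma] were also below [alpha] at [k], it would lie in the set [nabla] of the singleton
       [k0]. *)
    exists gamma; split=> //; apply/eqP; rewrite eq_le gal leNgt.
    apply/negP => lt; apply: nn; exists gamma, k0; split.
    - exact: gen_of_class cg sg.
    - by move=> j; rewrite inE => /eqP ->; rewrite ge bk0.
    - move=> j; rewrite inE => jk0; have [->//|jk] := eqVneq j k.
      by apply: gbl; rewrite !inE negb_or jk0.
  have ca : in_class t alpha.
    move=> k; have [->|/comp[gamma [cg _ _ <- _]]] := eqVneq k k0; last exact: cg.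
    by rewrite -ge0; apply: cg0.
  split=> //; apply/eqP; rewrite eq_le; apply/andP; split; last first.
    have [|gamma [cg sg le _ lt]] := comp k1; first by rewrite eq_sym.
    have := @class_sum_drop t alpha gamma (~: [set k0; k1]) ca cg le.
    move=> /(_ _)/(le_trans sg); rewrite subr_ge0 setC_card cards2 k01; apply.
    by move=> l; rewrite inE; apply: lt.
  rewrite leNgt; apply/negP => s1; apply: nn; exists (lower (~: [set k0]) alpha), k0.
  by apply: nablaJ_lower ca _; rewrite setC_card cards1; lia.
have ga : gen_semigroup Q alpha by apply: gen_of_class ca _; rewrite sa; lia.
split.
  split=> // -[beta [j b]]; have := nablaJ_class_sum ca (set11 j) b.
  by rewrite sa setC_card cards1; lia.
move=> J pJ J2; exists (lower (~: J) alpha); apply: nablaJ_lower ca _.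
by rewrite sa setC_card; lia.
Qed.

Lemma class_criterion alpha (rho : int) :
  (exists t, in_class t alpha /\ class_sum t alpha = rho) <->
  exists! t, in_class t alpha /\ class_sum t alpha = rho.
Proof.
split=> [[t [ca sa]]|[t [ct _]]]; exists t => //; split=> // t' [ca' _].
exact: (@class_uniq _ _ k0 (alpha k0)).
Qed.

End Combinatorics.

(** * Functions regular outside the given places *)

Section RegularFunctions.

Variables (K : finFieldType) (k : fieldType) (io : {rmorphism {poly K} -> k}).
Hypothesis io_inj : injective io.
Hypothesis io_frac : forall a : k, exists g h, h != 0 /\ a = io g / io h.
Variable F : fieldExtType k.

Definition ext_place (v : F -> int) : Prop :=
  [/\ valuation v, exists z, v z = 1
    & forall c : K, c != 0 -> v (io c%:P)%:A = 0].

Hypothesis place_exists : forall (R : F -> Prop) z, subring R ->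
  (forall c : K, R (io c%:P)%:A) -> z != 0 -> R z^-1 -> ~ R z ->
  exists2 v, ext_place v & (forall w, R w -> 0 <= v w) /\ v z < 0.

Implicit Types (a b : k) (g h : {poly K}) (p : k -> int) (v : F -> int).

Notation rat_place := (rat_place io).

Lemma algM a b : (a * b)%:A = a%:A * b%:A :> F.
Proof. by rewrite -!in_algE rmorphM. Qed.

Lemma restrict_place v : ext_place v ->
  (forall a, v a%:A = 0) \/
  exists p, exists2 e : int, rat_place p & 0 < e /\ forall a, v a%:A = e * p a.
Proof.
move=> [vV _ vK]; have [[a va]|H] := boolp.pselect (exists a, v a%:A != 0); last first.
  left=> a; apply: boolp.contrapT => /eqP va; apply: H; by exists a.
right; have rV : valuation (fun a => v a%:A).
  split=> [|a' b' a0 b0|a' b' a0 b0 ab0]; first by rewrite scale0r val0.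
    by rewrite algM valM // alg_eq0.
  have [_ _ vD] := vV; rewrite scalerDl; apply: vD; rewrite ?alg_eq0 //.
  by rewrite -scalerDl alg_eq0.
have [|e [p [e0 pV pu vE]]] := valuation_normalize rV; first by exists a.
exists p, e => //; split=> // c c0.
by apply/eqP; have := vK c c0; rewrite vE => /eqP; rewrite mulf_eq0 gt_eqF.
Qed.

(** The place comes from the ring of fractions whose numerator has degree at most that of the
    denominator, which contains [1 / x] but not [x]; it is found on [F] and then restricted. *)
Lemma exists_infty_place : exists2 p, rat_place p & p (io 'X) < 0.
Proof.
pose R (w : F) := exists g h, [/\ h != 0, (size g <= size h)%N & w = (io g / io h)%:A].
have szM (g h g' h' : {poly K}) : h != 0 -> h' != 0 -> (size g <= size h)%N -> (size g' <= size h')%N ->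
    (size (g * g')%R <= size (h * h')%R)%N.
  move=> h0 h0' gh gh'; rewrite (size_mul h0 h0').
  by apply: (leq_trans (size_polyMleq _ _)); rewrite -!subn1 leq_sub2r // leq_add.
have RP : subring R.
  split.
  - by exists 1, 1; rewrite oner_neq0 rmorph1 divr1 scale1r.
  - move=> _ _ [g [h [h0 gh ->]]] [g' [h' [h0' gh' ->]]].
    exists (g * h' - g' * h), (h * h'); split; first by rewrite mulf_neq0.
      rewrite (leq_trans (size_polyD _ _)) // size_polyN geq_max (szM g h h' h') //=.
      by rewrite (mulrC h) (szM g' h' h h).
    rewrite -scalerBl; congr (_ *: _); rewrite rmorphB !rmorphM.
    have i0 : io h != 0 by rewrite io_eq0.
    have i0' : io h' != 0 by rewrite io_eq0.
    by field; rewrite i0 i0'.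
  - move=> _ _ [g [h [h0 gh ->]]] [g' [h' [h0' gh' ->]]].
    exists (g * g'), (h * h'); split; rewrite ?mulf_neq0 ?szM //.
    by rewrite -algM !rmorphM mulf_div.
have X0 : io 'X != 0 by rewrite io_eq0 // polyX_eq0.
have [||||v vP [_ vX]] := @place_exists R (io 'X)%:A RP.
- move=> c; exists c%:P, 1; rewrite oner_neq0 rmorph1 divr1; split=> //.
  by rewrite size_poly1 size_polyC leq_b1.
- by rewrite alg_eq0.
- exists 1, 'X; rewrite polyX_eq0 size_poly1 size_polyX; split=> //.
  by rewrite alg_div rmorph1 scale1r div1r.
- case=> g [h [h0 gh /eqP]]; rewrite -subr_eq0 -scalerBl alg_eq0 subr_eq0 => /eqP E.
  have : io ('X * h) = io g by rewrite rmorphM E divfK // io_eq0.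
  by move/io_inj => gE; move: gh; rewrite -gE mulrC size_mulX // ltnn.
have [vt|[p [e pP [e0 vE]]]] := restrict_place vP; first by rewrite vt in vX.
by exists p => //; move: vX; rewrite vE pmulr_rlt0.
Qed.

(** In lowest terms [g / h] with [h] nonconstant, [1 / h] is not a polynomial, so it has a pole at a
    place regular on K[x]. There [h] vanishes and, by Bezout, [g] does not, so the fraction has a
    pole. *)
Lemma poly_of_regular a :
  (forall p, rat_place p -> 0 <= p (io 'X) -> 0 <= p a) -> exists g, a = io g.
Proof.
move=> reg; have [g [h [h0 aE]]] := io_frac a.
wlog cop : g h h0 aE / coprimep g h.
  move=> H; apply: (H (g %/ gcdp g h) (h %/ gcdp g h)).
  - by rewrite dvdp_div_eq0 ?dvdp_gcdr.
  - have d0 : gcdp g h != 0 by rewrite gcdp_eq0 negb_and h0 orbT.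
    rewrite -[RHS]mulr1 -(divff (_ : io (gcdp g h) != 0)) ?io_eq0 // mulf_div.
    by rewrite -!rmorphM !divpK ?dvdp_gcdl ?dvdp_gcdr.
  - by apply: coprimep_div_gcd; rewrite h0 orbT.
have [/eqP/size_poly1P[c c0 hE]|sh] := eqVneq (size h) 1%N.
  exists (g * c^-1%:P); rewrite rmorphM aE hE; congr (_ * _).
  apply: (mulfI (_ : io c%:P != 0)); first by rewrite io_eq0 // polyC_eq0.
  rewrite mulfV ?io_eq0 ?polyC_eq0 // -rmorphM -polyCM mulfV //.
  by rewrite polyC1 rmorph1.
pose R (w : F) := exists q, w = (io q)%:A.
have RP : subring R.
  split.
  - by exists 1; rewrite rmorph1 scale1r.
  - by move=> _ _ [q ->] [q' ->]; exists (q - q'); rewrite rmorphB scalerBl.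
  - by move=> _ _ [q ->] [q' ->]; exists (q * q'); rewrite rmorphM algM.
have ih0 : io h != 0 by rewrite io_eq0.
have invA b : b != 0 -> (b^-1)%:A = b%:A^-1 :> F.
  by move=> b0; rewrite -[b^-1]div1r alg_div scale1r div1r.
have [||||v vP [vR vh]] := @place_exists R (io h)^-1%:A RP.
- by move=> c; exists c%:P.
- by rewrite alg_eq0 invr_eq0.
- by exists h; rewrite invA ?invrK.
- case=> q /eqP; rewrite -subr_eq0 -scalerBl alg_eq0 subr_eq0 => /eqP E.
  have : io (h * q) = io 1 by rewrite rmorphM -E rmorph1 mulfV.
  move/io_inj => hq; have := size_mul h0 (_ : q != 0); rewrite hq size_poly1.
  have q0 : q != 0 by apply/eqP => q0; move: hq; rewrite q0 mulr0 => /eqP; rewrite eq_sym oner_eq0.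
  move=> /(_ q0); move: sh h0 q0; rewrite -!size_poly_gt0.
  by case: (size h) => [|[|s]] //; case: (size q) => // s' _ _ _; rewrite addSn addnS.
have [vt|[p [e pP [e0 vE]]]] := restrict_place vP; first by rewrite vt in vh.
have pV : valuation p by case: pP.
have pX : 0 <= p (io 'X).
  by rewrite -(pmulr_rge0 _ e0) -vE; apply: vR; exists 'X.
have ph : 0 < p (io h) by move: vh; rewrite vE pmulr_rlt0 // valV // oppr_lt0.
have := reg p pP pX; rewrite aE.
have [g0|g0] := eqVneq g 0.
  by move: sh; rewrite g0 coprime0p in cop; rewrite -size_poly_eq1 in cop; rewrite cop.
rewrite val_div ?io_eq0 //.
have pg : p (io g) <= 0.
  rewrite leNgt; apply/negP => pg.
  have /Bezout_eq1_coprimepP[[u w] /= uw] := cop.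
  have : vge p 1 (io 1).
    rewrite -uw rmorphD !rmorphM -[1]add0r; apply: vgeD => //; apply: vgeM => //.
    - by rewrite vge00 // (val_poly_ge0 pP).
    - by rewrite vge_neq0 ?io_eq0 //; lia.
    - by rewrite vge00 // (val_poly_ge0 pP).
    - by rewrite vge_neq0 ?io_eq0 //; lia.
  by rewrite rmorph1 vge_neq0 ?oner_neq0 // val1.
by move: pg ph; lia.
Qed.

Variables (f : {poly K}) (f0 : f != 0) (deg_f : (1 < size f)%N).
Hypothesis f_split : exists s : seq K, f %= \prod_(a <- s) ('X - a%:P).
Variables (r : nat) (P : 'I_r -> k -> int).
Hypothesis P_place : forall j, rat_place (P j).
Hypothesis P_inj : forall j l, P j =1 P l -> j = l.
Hypothesis P_supp : forall p, rat_place p ->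
  p (io f) != 0 <-> exists j, p =1 P j.

Let PV j : valuation (P j). Proof. by case: (P_place j). Qed.

(** [option K] is the set of rational points of the projective line, with [None] at infinity. *)
Definition centered j (o : option K) : bool :=
  if o is Some b then 0 < P j (io ('X - b%:P)) else P j (io 'X) < 0.

Lemma supp_place_center j : exists o, centered j o.
Proof.
have [Xn|Xp] := ltP (P j (io 'X)) 0; first by exists None.
have Pf : P j (io f) != 0 by apply/(P_supp (P_place j)); exists j.
by have [b Pb] := val_split_zero io_inj (P_place j) f0 f_split Xp Pf; exists (Some b).
Qed.

Section Centers.

Variable center : 'I_r -> option K.
Hypothesis centerP : forall j, centered j (center j).

Lemma center_inj : injective center.
Proof.
move=> j l E; apply: P_inj; have := centerP j; have := centerP l; rewrite -E.
rewrite /centered; case: (center j) => [b|] Pl Pj.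
  exact: (rat_place_eq_finite io_inj io_frac (P_place j) (P_place l) Pj Pl).
exact: (rat_place_eq_infty io_inj io_frac (P_place j) (P_place l) Pj Pl).
Qed.

(** [f] is not constant, so infinity is a pole of [f]. *)
Lemma exists_infty : exists j, center j = None.
Proof.
have [p pP pX] := exists_infty_place.
have [j pj] : exists j, p =1 P j.
  apply/(P_supp pP); rewrite (val_infty io_inj io_frac pP pX f0) oppr_eq0.
  by case: (size f) deg_f => [|[|s]].
exists j; have := centerP j; rewrite /centered; case: (center j) => // b Pb.
by have := val_X_ge0 (P_place j) Pb; rewrite -pj leNgt pX.
Qed.

(** Infinity gets the trivial factor 1: the order there is determined by the finite ones. *)
Definition local_par j : k := if center j is Some b then io ('X - b%:P) else 1.

Lemma local_par_neq0 j : local_par j != 0.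
Proof. by rewrite /local_par; case: (center j) => [b|]; rewrite ?io_XsubC ?oner_neq0. Qed.

Lemma val_local_par_finite l (b : K) j : center l = Some b -> P l (local_par j) = (j == l)%:Z.
Proof.
move=> lb; have := centerP l; rewrite /centered lb => Pb.
have -> : (j == l) = (center j == Some b) by rewrite -lb (inj_eq center_inj).
rewrite /local_par; case: (center j) => [b'|]; last exact: val1.
exact: (val_XsubC io_inj io_frac (P_place l) Pb b').
Qed.

Lemma val_local_par_infty l j : center l = None -> P l (local_par j) = - (j != l)%:Z.
Proof.
move=> lb; have := centerP l; rewrite /centered lb => PX.
have -> : (j == l) = (center j == None) by rewrite -lb (inj_eq center_inj).
rewrite /local_par; case: (center j) => [b'|]; last by rewrite val1.
by rewrite (val_infty io_inj io_frac (P_place l) PX) ?polyXsubC_eq0 // size_XsubC.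
Qed.

Lemma val_local_par_other p j : rat_place p -> 0 <= p (io 'X) -> ~ p =1 P j ->
  p (local_par j) = 0.
Proof.
move=> pP pX pj; have pV : valuation p by case: pP.
rewrite /local_par; have := centerP j; rewrite /centered; case: (center j) => [b|_]; last exact: val1.
move=> Pb; have := val_poly_ge0 pP ('X - b%:P) pX.
rewrite le_eqVlt => /orP[/eqP <-//|pb]; case: pj.
exact: (rat_place_eq_finite io_inj io_frac pP (P_place j) pb Pb).
Qed.

Lemma val_prodz (L : fieldType) (v : L -> int) (I : finType) (s : I -> L) (c : I -> int) :
  valuation v -> (forall j, s j != 0) ->
  \prod_j s j ^ c j != 0 /\ v (\prod_j s j ^ c j) = \sum_j c j * v (s j).
Proof.
move=> vV s0; elim/big_rec2: _ => [|j y x _ [x0 xE]]; first by rewrite val1 // oner_neq0.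
by rewrite mulf_neq0 ?expfz_neq0 // valM ?expfz_neq0 // valXz // xE.
Qed.

Lemma outside_finite p : rat_place p -> (forall j, ~ p =1 P j) -> 0 <= p (io 'X).
Proof.
move=> pP pN; rewrite leNgt; apply/negP => pX; have [j ji] := exists_infty.
apply: (pN j); have := centerP j; rewrite /centered ji.
exact: (rat_place_eq_infty io_inj io_frac pP (P_place j) pX).
Qed.

Lemma sum_delta (c : 'I_r -> int) l : \sum_j c j * (j == l)%:Z = c l.
Proof.
rewrite (bigD1 l) //= eqxx mulr1 big1 ?addr0 // => j jl.
by rewrite (negPf jl) mulr0.
Qed.

(* Stripping the zeros and poles of [a] at the finite [P j] leaves a
   polynomial, which has no zero at infinity. *)
Lemma sum_val_le0 a : a != 0 ->
  (forall p, rat_place p -> (forall j, ~ p =1 P j) -> 0 <= p a) ->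
  \sum_j P j a <= 0.
Proof.
move=> a0 reg; set c := fun j => - P j a.
pose s := \prod_j local_par j ^ c j.
have sE (v : k -> int) : valuation v -> s != 0 /\ v s = \sum_j c j * v (local_par j).
  by move=> vV; apply: val_prodz => // j; exact: local_par_neq0.
have [o oN] := exists_infty; have [s0 _] := sE _ (PV o).
have [g gE] : exists g, a * s = io g.
  apply: poly_of_regular => p pP pX; have pV : valuation p by case: pP.
  rewrite valM // (sE p pV).2.
  have [[l pl]|pN] := boolp.pselect (exists l, p =1 P l).
    case E : (center l) => [b|]; last first.
      by have := centerP l; rewrite /centered E -pl ltNge pX.
    rewrite (eq_bigr (fun j => c j * (j == l)%:Z)) ?sum_delta ?pl /c ?subrr //.
    by move=> j _; rewrite pl (val_local_par_finite j E).
  have {}pN j : ~ p =1 P j by move=> pj; apply: pN; exists j.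
  rewrite big1 ?addr0; first exact: reg.
  by move=> j _; rewrite val_local_par_other // mulr0.
have g0 : g != 0 by rewrite -(io_eq0 io_inj) -gE mulf_neq0.
have := val_infty io_inj io_frac (P_place o) _ g0.
have := centerP o; rewrite /centered oN => PX /(_ PX); rewrite -gE valM // (sE _ (PV o)).2.
(* Each finite factor has a simple pole at infinity, so the total [\sum_j P j a] is the value at
   infinity of the polynomial [g]. *)
have -> : \sum_j c j * P o (local_par j) = \sum_j P j a - P o a.
  rewrite [in RHS](bigD1 o) //= addrAC subrr add0r (bigD1 o) //=.
  rewrite (val_local_par_infty o oN) eqxx oppr0 mulr0 add0r; apply: eq_bigr => j jo.
  by rewrite (val_local_par_infty j oN) jo /c mulrNN mulr1.
by rewrite addrC subrK => ->; rewrite oppr_le0.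
Qed.

Section Interpolation.

Variables (n : nat) (le_n_r : (n <= r)%N).
Hypotheses (n_gt0 : (0 < n)%N) (n_le_q : (n <= #|K|)%N).

(* This is where [n <= q] enters: if the infinite place is among the first [n],
   one of the [q] finite rational places is not. *)
Lemma exists_free_function : exists q : k, [/\ q != 0,
  forall j : 'I_r, (j < n)%N -> center j != None -> P j q = 0,
  forall j : 'I_r, (j < n)%N -> center j = None -> P j q = -1,
  forall j : 'I_r, (n <= j)%N -> 0 <= P j q
  & forall p, rat_place p -> (forall j, ~ p =1 P j) -> 0 <= p q].
Proof.
have [o oN] := exists_infty.
have oU j : center j = None -> j = o by move=> jN; apply: center_inj; rewrite jN oN.
have [on|no] := ltnP o n; last first.
  exists 1; split; rewrite ?oner_neq0 //; try by move=> j; rewrite val1.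
  - by move=> j jn /oU jo; move: no; rewrite -jo leqNgt jn.
  - by move=> p [pV _ _] _; rewrite val1.
pose A := [set center j | j : 'I_r in [pred j : 'I_r | (j < n)%N]].
(* [A] has at most [n] of the [q + 1] points and contains infinity. *)
have [b bA] : exists b : K, Some b \notin A.
  apply: boolp.contrapT => H.
  have AT : A = [set: option K].
    apply/setP => -[b|]; rewrite inE; last by apply/imsetP; exists o; rewrite ?oN.
    by apply: boolp.contrapT => /negP bA; apply: H; exists b.
  have := leq_imset_card center [pred j : 'I_r | (j < n)%N].
  rewrite -/A AT cardsT card_option.
  have -> : #|[pred j : 'I_r | (j < n)%N]| = n.
    by rewrite -sum1_card (big_ord_narrow le_n_r) sum1_card card_ord.
  by rewrite leqNgt ltnS n_le_q.
have bN (j : 'I_r) : (j < n)%N -> center j != Some b.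
  by move=> jn; apply: contraNneq bA => <-; apply/imsetP; exists j.
have b0 : io ('X - b%:P) != 0 by exact: io_XsubC.
exists (io ('X - b%:P)); split=> //.
- move=> j jn; have := bN j jn; have := centerP j; rewrite /centered.
  case: (center j) => [b'|] // Pb bb _.
  rewrite (val_XsubC io_inj io_frac (P_place j) Pb).
  by have -> : (b == b') = false by apply: contraNF bb => /eqP ->.
- move=> j jn jN; have := centerP j; rewrite /centered jN => PX.
  by rewrite (val_infty io_inj io_frac (P_place j) PX) ?polyXsubC_eq0 // size_XsubC.
- move=> j nj; apply: (val_poly_ge0 (P_place j)); rewrite leNgt; apply/negP => Xj.
  have jo : j = o.
    apply: P_inj; apply: (rat_place_eq_infty io_inj io_frac (P_place j) (P_place o) Xj _).
    by have := centerP o; rewrite /centered oN.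
  by move: on; rewrite -jo ltnNge nj.
- by move=> p pP pN; apply: (val_poly_ge0 pP); apply: outside_finite.
Qed.

(** The product of the [local_par j ^ c j] is right at the finite places and exceeds [c] at infinity
    by [S]. The factor [q ^ S] removes this excess if infinity is among the first [n] places, and
    changes the other values there by nothing. *)
Lemma exists_function_with_vals (c : 'I_r -> int) : \sum_j c j <= 0 ->
  exists a, [/\ a != 0, forall j : 'I_r, (j < n)%N -> P j a = c j,
    forall j, c j <= P j a
    & forall p, rat_place p -> (forall j, ~ p =1 P j) -> 0 <= p a].
Proof.
move=> cS; have [q [q0 qfin qinf qge qout]] := exists_free_function.
have [o oN] := exists_infty.
have oU j : center j = None -> j = o by move=> jN; apply: center_inj; rewrite jN oN.
pose S := - \sum_j c j; have S0 : 0 <= S by rewrite oppr_ge0.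
pose s := \prod_j local_par j ^ c j.
have sE (v : k -> int) : valuation v -> s != 0 /\ v s = \sum_j c j * v (local_par j).
  by move=> vV; apply: val_prodz => // j; exact: local_par_neq0.
have [s0 _] := sE _ (PV o).
have qS0 : q ^ S != 0 by rewrite expfz_neq0.
have aE (v : k -> int) : valuation v -> v (s * q ^ S) = \sum_j c j * v (local_par j) + S * v q.
  by move=> vV; rewrite valM // (sE v vV).2 valXz.
have fin j (b : K) : center j = Some b -> P j (s * q ^ S) = c j + S * P j q.
  move=> jb; rewrite aE // -[in RHS](sum_delta c j); congr (_ + _).
  by apply: eq_bigr => l _; rewrite (val_local_par_finite l jb).
have inf : P o (s * q ^ S) = c o + S * (1 + P o q).
  rewrite aE // mulrDr mulr1 addrA; congr (_ + _).
  rewrite /S [in RHS](bigD1 o) //= opprD addrA subrr add0r (bigD1 o) //=.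
  rewrite (val_local_par_infty o oN) eqxx oppr0 mulr0 add0r -sumrN.
  by apply: eq_bigr => j jo; rewrite (val_local_par_infty j oN) jo mulrN mulr1.
exists (s * q ^ S); split.
- by rewrite mulf_neq0.
- move=> j jn; case E : (center j) => [b|].
    by rewrite (fin j b E) qfin ?mulr0 ?addr0 // E.
  by have jo := oU j E; rewrite jo inf -jo qinf // subrr mulr0 addr0.
- move=> j; case E : (center j) => [b|].
    rewrite (fin j b E) lerDl mulr_ge0 //.
    by have [jn|/qge//] := ltnP j n; rewrite qfin // E.
  have jo := oU j E; rewrite jo inf lerDl mulr_ge0 //; rewrite -jo.
  by have [jn|/qge] := ltnP j n; [rewrite qinf // subrr | lia].
- move=> p pP pN; have pV : valuation p by case: pP.
  rewrite aE // big1 ?add0r; first by rewrite mulr_ge0 // qout.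
  move=> j _; rewrite val_local_par_other ?mulr0 //; first exact: outside_finite.
Qed.

End Interpolation.

End Centers.

(** * Semigroup elements and coordinates in powers of y *)

Section Kummer.

Variables (y : F) (m p0 : nat) (n : nat) (le_n_r : (n <= r)%N).
Variable Q : 'I_n -> F -> int.
Hypotheses (m_gt1 : (1 < m)%N) (ym : y ^+ m = (io f)%:A).
Hypotheses (p0_char : p0 \in [pchar k]) (p0_m : coprime p0 m).
Hypothesis y_span : forall z, exists c : 'I_m -> k, z = \sum_t c t *: y ^+ t.
Hypothesis Q_place : forall l, ext_place (Q l).
Hypothesis QP : forall l a, Q l a%:A = m%:Z * P (widen_ord le_n_r l) a.
Hypothesis Qy : forall l, Q l y = P (widen_ord le_n_r l) (io f).
Hypothesis Q_uniq : forall l v, ext_place v ->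
  (forall a, 0 < P (widen_ord le_n_r l) a -> 0 < v a%:A) -> v =1 Q l.
Hypothesis Pf_coprime : forall l : 'I_n, coprime m `|P (widen_ord le_n_r l) (io f)|.
Hypotheses (n_gt0 : (0 < n)%N) (n_le_q : (n <= #|K|)%N).

Let lambda j := P j (io f).
Let wd := widen_ord le_n_r.

Definition regular_off z : Prop :=
  forall v, ext_place v -> (forall l, ~ v =1 Q l) -> 0 <= v z.

Let m_gt0 : (0 < m)%N. Proof. exact: ltnW. Qed.

Let iof0 : io f != 0. Proof. by rewrite io_eq0. Qed.

Let QV l : valuation (Q l). Proof. by case: (Q_place l). Qed.

Lemma kummer_gen_neq0 : y != 0.
Proof.
apply/eqP => y0; move/eqP: ym.
by rewrite y0 expr0n eqn0Ngt m_gt0 eq_sym alg_eq0 (negPf iof0).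
Qed.

Lemma kummer_distinct l (t t' : 'I_m) :
  (m%:Z %| Q l (y ^+ t) - Q l (y ^+ t'))%Z -> t = t'.
Proof.
rewrite !valX // Qy => d.
apply: (class_uniq Pf_coprime (k := l) (a := - (t'%:Z * P (wd l) (io f)))).
  by rewrite addrC.
by rewrite addNr dvdz0.
Qed.

Lemma kummer_sum l (c : 'I_m -> k) t0 : c t0 != 0 ->
  \sum_t c t *: y ^+ t != 0 /\
  exists t, [/\ c t != 0,
    Q l (\sum_t c t *: y ^+ t) = m%:Z * P (wd l) (c t) + t%:Z * lambda (wd l)
  & forall t', c t' != 0 ->
     Q l (\sum_t c t *: y ^+ t) <= m%:Z * P (wd l) (c t') + t'%:Z * lambda (wd l)].
Proof.
have yt (t : 'I_m) : y ^+ t != 0 by rewrite expf_neq0 // kummer_gen_neq0.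
have yv (t : 'I_m) : Q l (y ^+ t) = t%:Z * lambda (wd l) by rewrite valX // Qy.
move=> ct; have [s0 [t [ct' QE tmin]]] :=
  @ram_sum _ _ _ _ _ (QV l) (QP l) m_gt0 _ _ yt (@kummer_distinct l) c t0 ct.
split=> //; exists t; split=> // [|t' ct1]; first by rewrite QE yv.
by rewrite QE; have := tmin t' ct1; rewrite !yv.
Qed.

Lemma kummer_free (c : 'I_m -> k) :
  \sum_t c t *: y ^+ t = 0 -> forall t, c t = 0.
Proof.
move=> c0 t; apply: boolp.contrapT => /eqP ct.
by have [] := @kummer_sum (Ordinal n_gt0) c t ct; rewrite c0 eqxx.
Qed.

(* If [z] were not integral over the local ring at [p], a place over [p]
   would give [z] a pole. *)
Lemma kummer_local_bound z p (c : 'I_m -> k) t : regular_off z -> rat_place p ->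
  (forall l : 'I_n, ~ p =1 P (wd l)) ->
  z = \sum_t c t *: y ^+ t -> c t != 0 -> 0 <= m%:Z * p (c t) + t%:Z * p (io f).
Proof.
move=> zreg pP pN zE ct; have [pV pu pK] := pP.
have z0 : z != 0 by rewrite zE; have [] := @kummer_sum (Ordinal n_gt0) c t ct.
pose O (w : F) := exists2 a, vge p 0 a & w = a%:A.
have OP : subring O.
  split.
  - by exists 1; [rewrite vge00 // val1 | rewrite scale1r].
  - by move=> _ _ [a pa ->] [b pb ->]; exists (a - b); [apply: vgeB | rewrite scalerBl].
  - by move=> _ _ [a pa ->] [b pb ->]; exists (a * b); [apply: vgeM0 | rewrite algM].
(* Membership of [z] in [O[1/z]] is integrality of [z] over [O], the local ring at [p]. *)
have [[g gO zg]|Rz] := boolp.pselect (adjoin O z^-1 z); last first.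
  have [|||||v vP [vR vz]] := @place_exists (adjoin O z^-1) z.
  - exact: subring_adjoin.
  - move=> b; apply: adjoin_sub => //; exists (io b%:P) => //.
    exact: (vge_const pP).
  - exact: z0.
  - exact: adjoin_gen.
  - exact: Rz.
  (* [v] is none of the [Q l]: it is regular on [O], so [v =1 Q l] would force [p =1 P (wd l)] by
     [val_dominate]. *)
  suff : 0 <= v z by rewrite leNgt vz.
  apply: zreg => // l vQ; apply: (pN l).
  have [_ [u pu1] _] := P_place (wd l).
  apply: val_dominate => //; first by exists u.
  move=> a pa; have : 0 <= v a%:A.
    by apply: vR; apply: adjoin_sub => //; exists a; rewrite ?vge00.
  by rewrite vQ QP pmulr_rge0.
have /boolp.choice[a aP] : forall i, exists a, vge p 0 a /\ g`_i = a%:A.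
  by move=> i; have [a pa gE] := gO i; exists a.
have d0 : (0 < size g)%N.
  rewrite lt0n size_poly_eq0; apply: contraNneq z0 => g0.
  by rewrite zg g0 horner0.
(* Multiplying [z = g(1/z)] by [z ^ (size g - 1)] gives a monic equation of degree [size g], with
   the coefficients of [g] in reverse order. *)
apply: (kummer_integral m_gt1 ym p0_char p0_m y_span kummer_free pV iof0
   (d := size g) (g := fun i => a (rev_ord i)) _ _ zE ct).
  by move=> i; have [] := aP (rev_ord i).
rewrite -{1}(prednK d0) exprS {1}zg horner_coef mulr_suml.
rewrite [RHS](reindex_inj rev_ord_inj) /=; apply: eq_bigr => i _.
have -> : (size g - (size g - i.+1).+1)%N = i.
  by rewrite subnSK ?ltn_ord // subKn // ltnW.
rewrite (aP i).2 mulr_algl -scalerAl; congr (_ *: _).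
have le : (i <= (size g).-1)%N by rewrite -ltnS prednK ?ltn_ord.
rewrite -{1}(subnK le) exprD mulrCA -exprMn mulVf // expr1n mulr1.
by rewrite -subn1 -subnDA add1n.
Qed.

Definition floor_sum (t : 'I_m) : int := \sum_j floor_div (t%:Z * lambda j) m.

Notation in_class := (in_class (fun l => lambda (wd l))).

(** At the first [n] places the ceiling is [- c] minus the floor; at the others [c] cancels the
    floor. What remains is minus a degree. *)
Lemma class_sum_vals (t : 'I_m) (c : 'I_r -> int) (gamma : 'I_n -> int) :
  (forall j : 'I_r, (n <= j)%N -> c j = - floor_div (t%:Z * lambda j) m) ->
  (forall l, gamma l = - (m%:Z * c (wd l) + t%:Z * lambda (wd l))) ->
  class_sum floor_sum t gamma = - \sum_j c j.
Proof.
move=> cE gE; pose fl j := floor_div (t%:Z * lambda j) m.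
have ceilE l : ceil_div (gamma l) m = - (c (wd l) + fl (wd l)).
  rewrite gE opprD -mulrN [m%:Z * _]mulrC addrC ceil_div_addM // ceil_divN.
  by rewrite opprD addrC.
have S : \sum_(l < n) (c (wd l) + fl (wd l)) = \sum_j (c j + fl j).
  rewrite [RHS](bigID (fun j : 'I_r => (j < n)%N)) /= [X in _ + X]big1 ?addr0.
    by rewrite (big_ord_narrow le_n_r).
  by move=> j; rewrite -leqNgt => nj; rewrite cE // addNr.
rewrite /class_sum (eq_bigr _ (fun l _ => ceilE l)) sumrN S big_split /=.
by rewrite opprD -addrA addNr addr0.
Qed.

Lemma gen_of_kummer_class (t : 'I_m) (alpha : 'I_n -> int) :
  in_class t alpha -> 0 <= class_sum floor_sum t alpha ->
  exists z, [/\ z != 0, regular_off z & forall l, alpha l = - Q l z].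
Proof.
move=> ca sa.
(* [c] lists the values wanted for [a] in [z = a * y ^ t]: at the first [n] places those giving
   [alpha] exactly, elsewhere the least ones that keep [z] regular. *)
pose c (j : 'I_r) : int := if insub (j : nat) is Some l then
  (- (alpha l + t%:Z * lambda (wd l)) %/ m%:Z)%Z
  else - floor_div (t%:Z * lambda j) m.
have cl l : alpha l = - (m%:Z * c (wd l) + t%:Z * lambda (wd l)).
  rewrite /c (_ : insub _ = Some l); last by rewrite -[RHS](valK l).
  by rewrite mulrC divzK ?dvdzN //; [ring | rewrite rpredN; apply: ca].
have cn (j : 'I_r) : (n <= j)%N -> c j = - floor_div (t%:Z * lambda j) m.
  by move=> nj; rewrite /c insubN // -leqNgt.
have [center centerP] := boolp.choice supp_place_center.
have [|a [a0 aE age aout]] := @exists_function_with_vals center centerP n le_n_r n_gt0 n_le_q c.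
  by rewrite -oppr_ge0 -(class_sum_vals cn cl).
have yt0 : y ^+ t != 0 by rewrite expf_neq0 // kummer_gen_neq0.
exists (a *: y ^+ t); split.
- by rewrite scaler_eq0 negb_or a0.
- move=> v vP vQ; have [vV _ _] := vP.
  (* The [m]-th power is [a ^ m * f ^ t], so regularity can be tested on K(x). *)
  suff : 0 <= v ((a *: y ^+ t) ^+ m) by rewrite valX // pmulr_rge0.
  rewrite exprZn -exprM mulnC exprM ym -algX -[a ^+ m *: _]mulr_algl -algM.
  have [->//|[p [e pP [e0 vE]]]] := restrict_place vP.
  have [pV _ _] := pP; rewrite vE pmulr_rge0 // valM ?expf_neq0 // !valX //.
  have [[j pj]|pN] := boolp.pselect (exists j, p =1 P j); last first.
    have -> : p (io f) = 0.
      by apply: boolp.contrapT => /eqP /(P_supp pP).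
    by rewrite mulr0 addr0 mulr_ge0 // aout // => j pj; apply: pN; exists j.
  have [jn|nj] := ltnP j n.
    case: (vQ (Ordinal jn)); apply: Q_uniq => // b.
    have -> : widen_ord le_n_r (Ordinal jn) = j by apply: val_inj.
    by rewrite vE pj pmulr_rgt0.
  by rewrite !pj -floor_div_leP // -cn // age.
- move=> l; rewrite cl -aE; last by rewrite /= ltn_ord.
  by rewrite -mulr_algl valM ?alg_eq0 // QP valX // Qy.
Qed.

(** Take the term [c t * y ^ t] that attains the value of [z] at [Q l]; at the other [Q l'] its pole
    order is at most that of [z]. *)
Lemma kummer_class_of_gen z : z != 0 -> regular_off z ->
  forall l, exists (t : 'I_m) gamma, [/\ in_class t gamma,
    0 <= class_sum floor_sum t gamma, forall l', gamma l' <= - Q l' z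
    & gamma l = - Q l z].
Proof.
move=> z0 zreg l; have [c zE] := y_span z.
have [t0 ct0] : exists t, c t != 0.
  apply: boolp.contrapT => H; case/eqP: z0; rewrite zE big1 // => t _.
  have [->|ct] := eqVneq (c t) 0; first by rewrite scale0r.
  by case: H; exists t.
have [_ [t [ct QE _]]] := @kummer_sum l c t0 ct0; rewrite -zE in QE.
pose gamma l' := - (m%:Z * P (wd l') (c t) + t%:Z * lambda (wd l')).
exists t, gamma; split.
- by move=> l'; rewrite /gamma opprD subrK rpredN dvdz_mulr.
(* [w] lies below the values of [c t] by [kummer_local_bound], and these add up to at most 0 by
   [sum_val_le0]. *)
- pose w (j : 'I_r) := if (j < n)%N then P j (c t) else - floor_div (t%:Z * lambda j) m.
  rewrite (@class_sum_vals t w).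
  + rewrite oppr_ge0; have [center centerP] := boolp.choice supp_place_center.
    apply: le_trans (sum_val_le0 centerP ct _).
      apply: ler_sum => j _; rewrite /w; case: ltnP => // nj.
      rewrite floor_div_leP //.
      apply: (kummer_local_bound zreg (P_place j) _ zE ct) => l' /P_inj jl.
      by move: nj; rewrite jl /= leqNgt ltn_ord.
    move=> p pP pN.
    have := kummer_local_bound zreg pP (fun l' => pN (wd l')) zE ct.
    have -> : p (io f) = 0.
      by apply: boolp.contrapT => /eqP /(P_supp pP)[j /pN].
    by rewrite mulr0 addr0 pmulr_rge0.
  + by move=> j nj; rewrite /w ltnNge nj.
  + by move=> l'; rewrite /w /= ltn_ord.
- move=> l'; rewrite lerN2; have [_ [_ [_ _]]] := @kummer_sum l' c t0 ct0.
  by move=> /(_ t ct); rewrite -zE.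
- by rewrite /gamma QE.
Qed.

End Kummer.

End RegularFunctions.

(** * The criterion over a field of fractions of K[x] *)

Section Criterion.

Variables (K : finFieldType) (k : fieldType) (io : {rmorphism {poly K} -> k}).
Hypothesis io_inj : injective io.
Hypothesis io_frac : forall a : k, exists g h, h != 0 /\ a = io g / io h.
Variables (F : fieldExtType k) (i : {rmorphism K -> F}).
Hypothesis iE : forall c, i c = (io c%:P)%:A.
Hypothesis place_exists : forall (R : F -> Prop) z, subring R ->
  (forall c : K, R (io c%:P)%:A) -> z != 0 -> R z^-1 -> ~ R z ->
  exists v : place i, (forall w, R w -> 0 <= v w) /\ v z < 0.

Variables (f : {poly K}) (deg_f : (1 < size f)%N).
Hypothesis f_split : exists s : seq K, f %= \prod_(a <- s) ('X - a%:P).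
Variables (r : nat) (P : 'I_r -> k -> int).
Hypothesis P_place : forall j, rat_place io (P j).
Hypothesis P_inj : forall j l, P j =1 P l -> j = l.
Hypothesis P_supp : forall p, rat_place io p ->
  p (io f) != 0 <-> exists j, p =1 P j.

Variables (m : nat) (m_gt1 : (1 < m)%N).
Hypothesis m_char : forall p : nat, p \in [pchar K] -> ~~ (p %| m)%N.
Hypothesis f_npow : forall d : nat, (1 < d)%N -> (d %| m)%N ->
  ~ exists g : k, io f = g ^+ d.
Variables (y : F) (ym : y ^+ m = (io f)%:A) (ygen : <<1; y>>%VS = {:F}%VS).
Variables (n : nat) (le_n_r : (n <= r)%N).
Let wd := widen_ord le_n_r.
Hypothesis P_ram : forall l : 'I_n, exists Q' : place i,
  (forall v : place i, (forall a, 0 < P (wd l) a -> 0 < v a%:A) -> v =1 Q') /\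
  (forall a, Q' a%:A = (\dim {:F})%:Z * P (wd l) a).
Variable Q : 'I_n -> place i.
Hypothesis Q_over : forall l a, 0 < P (wd l) a -> 0 < Q l a%:A.
Hypotheses (n_ge2 : (2 <= n)%N) (n_le_q : (n <= #|K|)%N).

Lemma place_ext_place (v : place i) : ext_place io v.
Proof.
split; first by split; [exact: place_val0 | exact: place_valM | exact: place_valD].
  exact: place_val_unif.
by move=> c c0; rewrite -iE place_val_const.
Qed.

Lemma ext_place_place v : ext_place io v -> exists w : place i, v = w.
Proof.
move=> [[v0 vM vD] vu vK]; have vK' c : c != 0 -> v (i c) = 0 by rewrite iE; apply: vK.
by exists (Place v0 vM vD vK' vu).
Qed.

Lemma exists_ext_place (R : F -> Prop) z : subring R ->
  (forall c : K, R (io c%:P)%:A) -> z != 0 -> R z^-1 -> ~ R z ->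
  exists2 v, ext_place io v & (forall w, R w -> 0 <= v w) /\ v z < 0.
Proof.
move=> RP RK z0 Rz' Rz; have [v vP] := place_exists RP RK z0 Rz' Rz.
by exists v => //; exact: place_ext_place.
Qed.

Theorem kummer_criterion (alpha : 'I_n -> int) :
  let lambda j := P j (io f) in
  let criterion (rho : int) : Prop :=
    exists! t : 'I_m,
      (forall l : 'I_n, (m%:Z %| alpha l + t%:Z * lambda (wd l))%Z) /\
      \sum_(l < n) ceil_div (alpha l) m
        + \sum_(j < r) floor_div (t%:Z * lambda j) m = rho in
  (abs_maximal Q alpha <-> criterion 0) /\
  (rel_maximal Q alpha <-> criterion (n%:Z - 2)).
Proof.
move=> lambda criterion.
have m_gt0 : (0 < m)%N by exact: ltnW.
have n_gt0 : (0 < n)%N by exact: ltnW.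
have f0 : f != 0 by rewrite -size_poly_gt0 ltnW.
have iof0 : io f != 0 by rewrite io_eq0.
have [p0 p0P p0K] := finPcharP K.
have p0k : p0 \in [pchar k] by apply: (rmorph_pchar (io \o polyC)).
have p0m : coprime p0 m by rewrite prime_coprime // m_char.
have natE d : d%:R = io (d%:R)%:P by rewrite polyC_natr rmorph_nat.
(* Divisors of [m] are prime to the characteristic, so they are nonzero constants. *)
have dm (d : nat) j : (d %| m)%N -> P j d%:R = 0 /\ d%:R != 0 :> k.
  move=> d_m; have dK : d%:R != 0 :> K.
    rewrite -(dvdn_pcharf p0K); apply: contra (m_char p0K) => pd.
    exact: dvdn_trans pd d_m.
  by rewrite natE io_eq0 // polyC_eq0 dK (val_const (P_place j)).
have PV j : valuation (P j) by case: (P_place j).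
have QV l : valuation (Q l) by case: (place_ext_place (Q l)).
have Quniq l (v : place i) : (forall a, 0 < P (wd l) a -> 0 < v a%:A) -> v =1 Q l.
  move=> vP z; have [Q' [Qu _]] := P_ram l.
  by rewrite (Qu v vP) (Qu (Q l) (@Q_over l)).
have QP0 l a : Q l a%:A = (\dim {:F})%:Z * P (wd l) a.
  by have [Q' [Qu Q'P]] := P_ram l; rewrite (Qu (Q l) (@Q_over l)).
have e_gt0 : (0 < \dim {:F})%N by exact: adim_gt0.
have cop l : coprime m `|P (wd l) (io f)|.
  have [_ [pi Ppi] _] := P_place (wd l).
  apply: (ram_kummer_coprime (PV _) (QV l) (QP0 l) e_gt0 erefl (place_val_unif (Q l))
    Ppi iof0 ym m_gt0) => // d.
  exact: dm.
have l0 : 'I_n := Ordinal n_gt0.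
(* The ramification index, known so far only as the degree of [F], is [m]. *)
have [dimE _] := ram_kummer_dim (QV l0) (QP0 l0) e_gt0 erefl iof0 ym m_gt0 ygen (cop l0).
have QP l a : Q l a%:A = m%:Z * P (wd l) a by rewrite QP0 dimE.
have Qy l : Q l y = P (wd l) (io f).
  by have [] := ram_kummer_dim (QV l) (QP0 l) e_gt0 erefl iof0 ym m_gt0 ygen (cop l).
have Qpl l : ext_place io (Q l) by exact: place_ext_place.
have y_span z : exists c : 'I_m -> k, z = \sum_t c t *: y ^+ t.
  apply: (ram_basis (QV l0) (QP l0) m_gt0); last by rewrite dimE.
  - move=> t; rewrite expf_neq0 //.
    exact: (kummer_gen_neq0 io_inj f0 m_gt1 ym).
  - exact: (kummer_distinct Qpl Qy cop (l := l0)).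
have Quniq' l v : ext_place io v ->
    (forall a, 0 < P (wd l) a -> 0 < v a%:A) -> v =1 Q l.
  by move=> /ext_place_place[w ->]; apply: Quniq.
have reg z : regular_outside Q z <-> regular_off io (fun l => Q l) z.
  split=> zreg; last by move=> w wN; apply: zreg => //; exact: place_ext_place.
  by move=> v /ext_place_place[w ->] wN; apply: zreg.
pose A := @floor_sum _ _ io f _ P m.
have genC t beta : in_class (fun l => lambda (wd l)) t beta ->
    0 <= class_sum A t beta -> gen_semigroup Q beta.
  move=> cb sb.
  have [z [z0 /reg zr zE]] := gen_of_kummer_class io_inj io_frac exists_ext_place f0 deg_f
    f_split P_place P_inj P_supp m_gt1 ym Qpl QP Qy Quniq' n_gt0 n_le_q cb sb.
  by exists z.
have Cgen beta : gen_semigroup Q beta -> forall l, exists t gamma,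
   [/\ in_class (fun l => lambda (wd l)) t gamma, 0 <= class_sum A t gamma,
     forall l', gamma l' <= beta l' & gamma l = beta l].
  move=> [z [z0 /reg zr zE]] l.
  have [t [gamma [cg sg le ge]]] := kummer_class_of_gen io_inj io_frac exists_ext_place f0 deg_f
    f_split P_place P_inj P_supp m_gt1 ym p0k p0m y_span Qpl QP Qy cop n_gt0 z0 zr l.
  by exists t, gamma; split=> // [l'|]; rewrite zE.
split.
  apply: (iff_trans (abs_maximal_class m_gt0 n_ge2 cop genC Cgen alpha)).
  exact: class_criterion.
apply: (iff_trans (rel_maximal_class m_gt0 n_ge2 cop genC Cgen alpha)).
exact: class_criterion.
Qed.

End Criterion.

Theorem lemma3p3
  (K : finFieldType) (m : nat) (f : {poly K})
  (m_ge2 : (2 <= m)%N)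
  (m_char : forall p : nat, p \in [pchar K] -> ~~ (p %| m)%N)
  (deg_f : (2 <= (size f).-1)%N)
  (f_split : exists s : seq K, f %= \prod_(a <- s) ('X - a%:P))
  (f_npow : forall d : nat, (1 < d)%N -> (d %| m)%N ->
     ~ exists g : {fraction {poly K}}, tofrac f = g ^+ d)
  (* the function field F = K(x, y) with y ^ m = f(x) *)
  (F : fieldExtType {fraction {poly K}}) (y : F)
  (y_eq : y ^+ m = (tofrac f)%:A)
  (y_gen : <<1; y>>%VS = {:F}%VS)
  (* the zeros and poles of f in K(x) *)
  (r : nat) (P : 'I_r -> place (ratfun_const K))
  (P_inj : forall k l : 'I_r, P k =1 P l -> k = l)
  (P_supp : forall p : place (ratfun_const K),
     p (tofrac f) != 0 <-> exists k : 'I_r, p =1 P k)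
  (n : nat) (le_n_r : (n <= r)%N)
  (P_ram : forall k : 'I_n, totally_ramified F (P (widen_ord le_n_r k)))
  (Q : 'I_n -> place (ext_const F))
  (Q_over : forall k : 'I_n, lies_over (Q k) (P (widen_ord le_n_r k)))
  (n_ge2 : (2 <= n)%N) (n_le_q : (n <= #|K|)%N)
  (alpha : 'I_n -> int) :
  let lambda (k : 'I_r) : int := P k (tofrac f) in
  let criterion (rho : int) : Prop :=
    exists! t : 'I_m,
      (forall k : 'I_n,
         (m%:Z %| alpha k + t%:Z * lambda (widen_ord le_n_r k))%Z) /\
      \sum_(k < n) ceil_div (alpha k) m
        + \sum_(k < r) floor_div (t%:Z * lambda k) m = rho in
  (abs_maximal Q alpha <-> criterion 0) /\
  (rel_maximal Q alpha <-> criterion (n%:Z - 2)).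
Proof.
move=> lambda criterion.
have io_inj : injective (@tofrac {poly K}) by move=> g h /eqP; rewrite tofrac_eq => /eqP.
have deg_f' : (1 < size f)%N by move: deg_f; case: (size f) => [|[|s]].
have rat_of_place (p : place (ratfun_const K)) : rat_place (@tofrac {poly K}) p.
  split; first by split; [exact: place_val0 | exact: place_valM | exact: place_valD].
    exact: place_val_unif.
  by move=> c c0; exact: (place_val_const p c0).
have place_of_rat p : rat_place (@tofrac {poly K}) p ->
    exists q : place (ratfun_const K), p = q.
  by move=> [[p0 pM pD] pu pK]; exists (@Place _ _ (ratfun_const K) p p0 pM pD pK pu).
apply: (@kummer_criterion K (ratfun K) (@tofrac {poly K}) io_inj (@ratfun_fracE K)
  F (ext_const F) (fun=> erefl) (@exists_place K F) f deg_f' f_split r P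
  (fun j => rat_of_place (P j)) P_inj _ m m_ge2 m_char f_npow y y_eq y_gen n le_n_r
  _ Q Q_over n_ge2 n_le_q alpha).
- by move=> p /place_of_rat[q ->]; apply: P_supp.
- by move=> l; have [Q' [_ Qu QP]] := P_ram l; exists Q'.
Qed.
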